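(* Let $(\varGamma,C)$ be a split-step SUSYQW with anisotropic coin $C$. Then $Q_{\epsilon_+}$ has closed range if and only if $|p|\ne|a(\sharp)|$ for every $\sharp\in\{\mathrm L,\mathrm R\}$ for which $b(\sharp)\ne0$ (i.e. for which $C(\sharp)$ is not diagonal).
   Context: Let $L$ be the left shift $(L\Psi)(x)=\Psi(x+1)$ on $\ell^2(\mathbb Z)$. A split-step SUSYQW is $\varGamma=\begin{pmatrix} p & qL\\ \overline{q}L^* & -p\end{pmatrix}$, $C=\begin{pmatrix} a_1 & \overline{b}\\ b & a_2\end{pmatrix}$ on $\ell^2(\mathbb Z)\oplus\ell^2(\mathbb Z)$ with $p\in\mathbb R$, $q\in\mathbb C\setminus\{0\}$, $p^2+|q|^2=1$, $\theta=\operatorname{Arg}q$, real sequences $a_1,a_2$ and complex sequence $b$ on $\mathbb Z$ (as multiplication operators) with $a_j(x)^2+|b(x)|^2=1$, $b(x)(a_1(x)+a_2(x))=0$. $C$ is anisotropic if $C(\mathrm L)=\lim_{x\to-\infty}C(x)$ and $C(\mathrm R)=\lim_{x\to+\infty}C(x)$ exist, where $C(x)=\begin{pmatrix} a_1(x)&\overline{b(x)}\\ b(x)&a_2(x)\end{pmatrix}$; $a_j(\sharp),b(\sharp)$ denote the entries of $C(\sharp)$. When $b(\sharp)\neq0$, necessarily $a_1(\sharp)=-a_2(\sharp)=:a(\sharp)$ with $a(\sharp)^2+|b(\sharp)|^2=1$. $Q_{\epsilon_+}$ is the operator on $\ell^2(\mathbb Z)$ given by $-2iQ_{\epsilon_+}=(1+p)e^{i\theta}Lb-(1-p)e^{-i\theta}\overline{b}L^*+|q|(a_2(\cdot+1)-a_1)$.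 *)

(* Defs.v *)
From Stdlib Require Import Reals ZArith.
Open Scope R_scope.

Definition Cx : Type := (R * R)%type.
Definition Cre (z : Cx) : R := fst z.
Definition Cim (z : Cx) : R := snd z.
Definition RtoC (r : R) : Cx := (r, 0).
Definition C0 : Cx := (0, 0).
Definition Ci : Cx := (0, 1).
Definition Cadd (z w : Cx) : Cx := (fst z + fst w, snd z + snd w).
Definition Copp (z : Cx) : Cx := (- fst z, - snd z).
Definition Csub (z w : Cx) : Cx := Cadd z (Copp w).
Definition Cmul (z w : Cx) : Cx :=
  (fst z * fst w - snd z * snd w, fst z * snd w + snd z * fst w).
Definition Cconj (z : Cx) : Cx := (fst z, - snd z).
Definition Cnorm2 (z : Cx) : R := fst z * fst z + snd z * snd z.
Definition Cabs (z : Cx) : R := sqrt (Cnorm2 z).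
Definition Cscale (r : R) (z : Cx) : Cx := (r * fst z, r * snd z).

Definition seqZ : Type := Z -> Cx.

Definition partial_norm2 (f : seqZ) (n : nat) : R :=
  sum_f_R0 (fun k => Cnorm2 (f (Z.of_nat k - Z.of_nat n)%Z)) (2 * n).

Definition in_l2 (f : seqZ) : Prop :=
  exists M : R, forall n : nat, partial_norm2 f n <= M.

(** ||f||_{l^2} < eps  (for eps > 0), i.e. sum_x |f x|^2 < eps^2. *)
Definition l2_norm_lt (f : seqZ) (eps : R) : Prop :=
  exists d : R, d < eps * eps /\ forall n : nat, partial_norm2 f n <= d.

Definition seq_sub (f g : seqZ) : seqZ := fun x => Csub (f x) (g x).

(** A linear operator T on l^2(Z) (given on all of Cx^Z) has closed range:
    every element of l^2(Z) lying in the l^2-closure of T(l^2(Z)) lies in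
    T(l^2(Z)). *)
Definition closed_range (T : seqZ -> seqZ) : Prop :=
  forall y : seqZ, in_l2 y ->
    (forall eps : R, 0 < eps ->
       exists psi : seqZ, in_l2 psi /\ l2_norm_lt (seq_sub (T psi) y) eps) ->
    exists psi : seqZ, in_l2 psi /\ T psi = y.

Definition lim_left_R (f : Z -> R) (l : R) : Prop :=
  forall eps, 0 < eps -> exists N : Z, forall x : Z, (x <= N)%Z -> Rabs (f x - l) < eps.
Definition lim_right_R (f : Z -> R) (l : R) : Prop :=
  forall eps, 0 < eps -> exists N : Z, forall x : Z, (N <= x)%Z -> Rabs (f x - l) < eps.
Definition lim_left_C (f : Z -> Cx) (l : Cx) : Prop :=
  forall eps, 0 < eps -> exists N : Z, forall x : Z, (x <= N)%Z -> Cabs (Csub (f x) l) < eps.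
Definition lim_right_C (f : Z -> Cx) (l : Cx) : Prop :=
  forall eps, 0 < eps -> exists N : Z, forall x : Z, (N <= x)%Z -> Cabs (Csub (f x) l) < eps.

(** e^{i Arg q} = q / |q| for q <> 0. *)
Definition expiArg (q : Cx) : Cx := Cscale (/ Cabs q) q.

(** The operator T := -2i Q_{eps_+}:
    T psi = (1+p) e^{i theta} L (b psi) - (1-p) e^{-i theta} conj(b) L^* psi
            + |q| (a2(.+1) - a1) psi,
    with (L psi)(x) = psi(x+1), (L^* psi)(x) = psi(x-1). *)
Definition Tminus2iQ (p : R) (q : Cx) (a1 a2 : Z -> R) (b : Z -> Cx)
  (psi : seqZ) : seqZ :=
  fun x =>
    Cadd (Csub
      (Cmul (Cscale (1 + p) (expiArg q)) (Cmul (b (x + 1)%Z) (psi (x + 1)%Z)))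
      (Cmul (Cscale (1 - p) (Cconj (expiArg q))) (Cmul (Cconj (b x)) (psi (x - 1)%Z))))
      (Cmul (RtoC (Cabs q * (a2 (x + 1)%Z - a1 x))) (psi x)).

(** Q_{eps_+} = (i/2) T, since -2i Q = T. *)
Definition Qeps (p : R) (q : Cx) (a1 a2 : Z -> R) (b : Z -> Cx) (psi : seqZ) : seqZ :=
  fun x => Cmul (Cscale (/ 2) Ci) (Tminus2iQ p q a1 a2 b psi x).

(* Main.v *)
Require Import Defs.
From Stdlib Require Import Reals ZArith Lra Lia List Classical.
From Stdlib Require Import ClassicalEpsilon FunctionalExtensionality IndefiniteDescription.
Open Scope R_scope.

(** The operator is tridiagonal with coefficients converging at both ends.

    At an end with [b <> 0] the limiting operator is, up to a scalar, [(U - w1) (1 - w2 U^-1)]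
    with [U] a unimodular multiple of the left shift and [w1], [w2] real; [|w1| = 1] or
    [|w2| = 1] exactly when [|p| = |a|].  If both moduli differ from [1], the operator is
    bounded below on sequences supported far out at that end.  At a diagonal end either the
    limiting operator is a nonzero scalar, or [a1] and [a2] have the same limit, and then
    [b (a1 + a2) = 0] forces [b = 0] and [a1 = a2 = const] far out, so that the operator
    vanishes there.  Hence, when the condition holds, the range is a closed subspace plus the
    span of finitely many vectors, which is closed.

    If the condition fails at some end, truncated plane waves give norm-one vectors [f_k] with
    disjoint finite supports escaping to that end and images of norm at most
    [2^-k].  For bounded [c] the image of the formal series [sum c_k f_k] lies in the closure of
    the range; a solution in l2 for each of three independent choices of [c] would contradict the
    kernel of the recurrence on a half line having dimension two. *)

(* Complex arithmetic as a commutative ring, with modulus and inverse *)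
Declare Scope cx_scope.
Delimit Scope cx_scope with Cx.
Infix "+" := Cadd : cx_scope.
Infix "-" := Csub : cx_scope.
Infix "*" := Cmul : cx_scope.
Notation "- z" := (Copp z) : cx_scope.

Definition Cone : Cx := RtoC 1.
Definition Cinv (z : Cx) : Cx := Cscale (/ Cnorm2 z) (Cconj z).

Ltac cx_unfold :=
  unfold Cone, Cinv, Csub, Cadd, Copp, Cmul, Cscale, Cconj, RtoC, C0, Ci, Cnorm2 in *;
  simpl fst in *; simpl snd in *.
Ltac cx_eq := cx_unfold; f_equal.

Lemma Cx_ring : ring_theory C0 Cone Cadd Cmul Csub Copp eq.
Proof. split; intros; repeat match goal with z : Cx |- _ => destruct z end; cx_eq; ring. Qed.
Add Ring Cx_ring : Cx_ring.

Lemma Cnorm2_nonneg z : 0 <= Cnorm2 z.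
Proof. unfold Cnorm2; nra. Qed.

Lemma Cnorm2_eq0 z : Cnorm2 z = 0 -> z = C0.
Proof. destruct z as [x y]; cx_unfold; intro H; f_equal; nra. Qed.

Lemma Cnorm2_C0 : Cnorm2 C0 = 0.
Proof. cx_unfold; ring. Qed.

Lemma Cnorm2_Cone : Cnorm2 Cone = 1.
Proof. cx_unfold; ring. Qed.

Lemma Cnorm2_pos z : z <> C0 -> 0 < Cnorm2 z.
Proof.
intro H; destruct (Cnorm2_nonneg z) as [h | h]; [exact h |].
now elim H; apply Cnorm2_eq0.
Qed.

Lemma Cnorm2_mul z w : Cnorm2 (z * w)%Cx = Cnorm2 z * Cnorm2 w.
Proof. cx_unfold; ring. Qed.

Lemma Cnorm2_RtoC r : Cnorm2 (RtoC r) = r * r.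
Proof. cx_unfold; ring. Qed.

Lemma Cnorm2_conj z : Cnorm2 (Cconj z) = Cnorm2 z.
Proof. cx_unfold; ring. Qed.

Lemma Cabs_nonneg z : 0 <= Cabs z.
Proof. apply sqrt_pos. Qed.

Lemma Cabs_sqr z : Cabs z * Cabs z = Cnorm2 z.
Proof. apply sqrt_sqrt, Cnorm2_nonneg. Qed.

Lemma Cabs_pos z : z <> C0 -> 0 < Cabs z.
Proof. intro H; apply sqrt_lt_R0, Cnorm2_pos, H. Qed.

Lemma Cmul_conj z : (z * Cconj z)%Cx = RtoC (Cabs z * Cabs z).
Proof. rewrite Cabs_sqr; cx_eq; ring. Qed.

Lemma Cconj_mul z w : Cconj (z * w)%Cx = (Cconj z * Cconj w)%Cx.
Proof. cx_eq; ring. Qed.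

Lemma Cconj_conj z : Cconj (Cconj z) = z.
Proof. destruct z; cx_eq; ring. Qed.

Lemma Cconj_RtoC r : Cconj (RtoC r) = RtoC r.
Proof. cx_eq; ring. Qed.

Lemma RtoC_mul r s : RtoC (r * s) = (RtoC r * RtoC s)%Cx.
Proof. cx_eq; ring. Qed.

Lemma RtoC_add r s : RtoC (r + s) = (RtoC r + RtoC s)%Cx.
Proof. cx_eq; ring. Qed.

Lemma Cabs_mul z w : Cabs (z * w)%Cx = Cabs z * Cabs w.
Proof. unfold Cabs; rewrite Cnorm2_mul; apply sqrt_mult; apply Cnorm2_nonneg. Qed.

Lemma Cmul_inv z : z <> C0 -> (z * Cinv z)%Cx = Cone.
Proof.
intro H; pose proof (Cnorm2_pos z H) as h.
destruct z as [x y]; unfold Cinv; cx_eq; field; lra.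
Qed.

Lemma Cmul_integral z w : (z * w)%Cx = C0 -> z = C0 \/ w = C0.
Proof.
intro H; destruct (classic (z = C0)) as [h | h]; [now left | right].
replace w with ((z * Cinv z) * w)%Cx by (rewrite (Cmul_inv z h); ring).
replace ((z * Cinv z) * w)%Cx with (Cinv z * (z * w))%Cx by ring.
rewrite H; ring.
Qed.

(** * Sums over symmetric windows and the norm of l2(Z) *)

(** The partial sums of [partial_norm2] are re-indexed whenever [n] grows. Here a larger window only
    adds its two new end sites, so induction on [n] is direct. *)
Fixpoint wsum (h : Z -> R) (n : nat) : R :=
  match n with
  | O => h 0%Z
  | S m => wsum h m + (h (Z.of_nat n) + h (- Z.of_nat n)%Z)
  end.

Lemma partial_norm2_wsum f n : partial_norm2 f n = wsum (fun x => Cnorm2 (f x)) n.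
Proof.
unfold partial_norm2; induction n as [| n IH]; [reflexivity |].
(* The two new sites are the last and the first term: [tech5] splits off the one, [decomp_sum] the
   other. *)
replace (2 * S n)%nat with (S (S (2 * n))) by lia.
rewrite tech5, decomp_sum by lia.
cbn [wsum pred]; rewrite <- IH.
replace (Z.of_nat (S (S (2 * n))) - Z.of_nat (S n))%Z with (Z.of_nat (S n)) by lia.
replace (Z.of_nat 0 - Z.of_nat (S n))%Z with (- Z.of_nat (S n))%Z by lia.
rewrite (sum_eq _ (fun k => Cnorm2 (f (Z.of_nat k - Z.of_nat n)%Z))).
  ring.
intros i _; do 2 f_equal; lia.
Qed.

Lemma wsum_le h g n :
  (forall x, (Z.abs x <= Z.of_nat n)%Z -> h x <= g x) -> wsum h n <= wsum g n.
Proof.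
induction n as [| n IH]; intro H; cbn [wsum]; [apply H; lia |].
assert (h (Z.of_nat (S n)) <= g (Z.of_nat (S n))) by (apply H; lia).
assert (h (- Z.of_nat (S n))%Z <= g (- Z.of_nat (S n))%Z) by (apply H; lia).
assert (wsum h n <= wsum g n) by (apply IH; intros; apply H; lia).
lra.
Qed.

Lemma wsum_ext h g n :
  (forall x, (Z.abs x <= Z.of_nat n)%Z -> h x = g x) -> wsum h n = wsum g n.
Proof. intro H; apply Rle_antisym; apply wsum_le; intros x hx; rewrite (H x hx); lra. Qed.

Lemma wsum_lin a h b g n :
  wsum (fun x => a * h x + b * g x) n = a * wsum h n + b * wsum g n.
Proof. induction n as [| n IH]; cbn [wsum]; [| rewrite IH]; ring. Qed.

Lemma wsum_scal a h n : wsum (fun x => a * h x) n = a * wsum h n.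
Proof. induction n as [| n IH]; cbn [wsum]; [| rewrite IH]; ring. Qed.

Lemma wsum_nonneg h n : (forall x, 0 <= h x) -> 0 <= wsum h n.
Proof.
intro H; induction n as [| n IH]; cbn [wsum]; [apply H |].
pose proof (H (Z.of_nat (S n))); pose proof (H (- Z.of_nat (S n))%Z); lra.
Qed.

Lemma wsum_mono h n m : (forall x, 0 <= h x) -> (n <= m)%nat -> wsum h n <= wsum h m.
Proof.
intros H; induction 1 as [| m _ IH]; [lra | cbn [wsum]].
pose proof (H (Z.of_nat (S m))); pose proof (H (- Z.of_nat (S m))%Z); lra.
Qed.

Lemma wsum_neg h n : wsum (fun x => h (- x)%Z) n = wsum h n.
Proof.
induction n as [| n IH]; cbn [wsum]; [reflexivity |].
rewrite IH, Z.opp_involutive; ring.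
Qed.

Lemma wsum_shift h n :
  wsum (fun x => h (x + 1)%Z) n = wsum h n + h (Z.of_nat n + 1)%Z - h (- Z.of_nat n)%Z.
Proof.
induction n as [| n IH]; cbn [wsum]; [simpl; ring |].
rewrite IH.
replace (- Z.of_nat (S n) + 1)%Z with (- Z.of_nat n)%Z by lia.
replace (Z.of_nat n + 1)%Z with (Z.of_nat (S n)) by lia.
ring.
Qed.

Lemma wsum_point y c n :
  wsum (fun x => if (x =? y)%Z then c else 0) n =
  if (Z.abs y <=? Z.of_nat n)%Z then c else 0.
Proof.
induction n as [| n IH]; cbn [wsum].
- destruct (Z.eqb_spec 0 y), (Z.leb_spec (Z.abs y) (Z.of_nat 0)); try lia; reflexivity.
- rewrite IH.
  destruct (Z.eqb_spec (Z.of_nat (S n)) y), (Z.eqb_spec (- Z.of_nat (S n)) y),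
    (Z.leb_spec (Z.abs y) (Z.of_nat n)), (Z.leb_spec (Z.abs y) (Z.of_nat (S n)));
    try lia; ring.
Qed.

(** Upper bounds stand in for the norm itself, so that estimates compose without suprema; [0 <= m]
    makes comparing squares the same as comparing norms. *)
Definition l2_le (f : seqZ) (m : R) : Prop :=
  0 <= m /\ forall n, wsum (fun x => Cnorm2 (f x)) n <= m * m.

Lemma l2_le_in_l2 f m : l2_le f m -> in_l2 f.
Proof. intros [_ H]; exists (m * m); intro n; rewrite partial_norm2_wsum; apply H. Qed.

(** The least bound is the square root of the supremum of the window sums. It serves where an
    estimate such as [s <= m + c * s] must be absorbed into its left side. *)
Lemma l2_norm_exists f :
  in_l2 f -> exists m, l2_le f m /\ forall m', l2_le f m' -> m <= m'.
Proof.
intros [M HM].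
destruct (completeness (fun r => exists n, r = wsum (fun x => Cnorm2 (f x)) n))
  as [s [Hs1 Hs2]].
- exists M; intros r [n ->]; rewrite <- partial_norm2_wsum; apply HM.
- now exists (wsum (fun x => Cnorm2 (f x)) 0), 0%nat.
- assert (0 <= s).
  { apply Rle_trans with (wsum (fun x => Cnorm2 (f x)) 0).
    - apply wsum_nonneg; intro; apply Cnorm2_nonneg.
    - apply Hs1; now exists 0%nat. }
  exists (sqrt s); split.
  + split; [apply sqrt_pos |]; intro n; rewrite sqrt_sqrt by easy.
    apply Hs1; now exists n.
  + intros m' [h0 h]; rewrite <- (sqrt_square m') by easy.
    apply sqrt_le_1_alt, Hs2; intros r [n ->]; apply h.
Qed.

Lemma in_l2_l2_le f : in_l2 f -> exists m, l2_le f m.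
Proof. intro H; destruct (l2_norm_exists f H) as [m [h _]]; now exists m. Qed.

Lemma l2_norm_lt_iff f e : 0 < e -> (l2_norm_lt f e <-> exists m, m < e /\ l2_le f m).
Proof.
intro He; split.
- intros [d [Hd H]].
  assert (0 <= d).
  { apply Rle_trans with (partial_norm2 f 0); [| apply H].
    rewrite partial_norm2_wsum; apply wsum_nonneg; intro; apply Cnorm2_nonneg. }
  exists (sqrt d); split.
  + rewrite <- (sqrt_square e) by lra; apply sqrt_lt_1_alt; lra.
  + split; [apply sqrt_pos |]; intro n; rewrite sqrt_sqrt by easy.
    rewrite <- partial_norm2_wsum; apply H.
- intros [m [Hm [H0 H]]]; exists (m * m); split; [nra |].
  intro n; rewrite partial_norm2_wsum; apply H.
Qed.

Lemma l2_le_dom f g k m :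
  0 <= k -> (forall x, Cnorm2 (g x) <= k * k * Cnorm2 (f x)) -> l2_le f m -> l2_le g (k * m).
Proof.
intros Hk H [Hm Hf]; split; [nra |]; intro n.
apply Rle_trans with (k * k * wsum (fun x => Cnorm2 (f x)) n).
- rewrite <- wsum_scal; apply wsum_le; intros; apply H.
- pose proof (Hf n); nra.
Qed.

Lemma l2_le_sub_dom f g m :
  (forall x, Cnorm2 (g x) <= Cnorm2 (f x)) -> l2_le f m -> l2_le g m.
Proof.
intros H Hf; rewrite <- (Rmult_1_l m); apply l2_le_dom with f; [lra | | easy].
intro x; specialize (H x); lra.
Qed.

Lemma l2_le_ext f g m : (forall x, f x = g x) -> l2_le f m -> l2_le g m.
Proof. intros H; apply l2_le_sub_dom; intro x; rewrite H; lra. Qed.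

Lemma l2_le_weaken f m m' : m <= m' -> l2_le f m -> l2_le f m'.
Proof. intros H [H0 Hf]; split; [lra |]; intro n; specialize (Hf n); nra. Qed.

Lemma l2_le_point f m x : l2_le f m -> Cnorm2 (f x) <= m * m.
Proof.
intros [_ H]; apply Rle_trans with (2 := H (Z.to_nat (Z.abs x))).
replace (Cnorm2 (f x)) with
  (wsum (fun t => if (t =? x)%Z then Cnorm2 (f x) else 0) (Z.to_nat (Z.abs x))).
- apply wsum_le; intros t _; destruct (Z.eqb_spec t x) as [-> |]; [lra |].
  apply Cnorm2_nonneg.
- rewrite wsum_point; destruct (Z.leb_spec (Z.abs x) (Z.of_nat (Z.to_nat (Z.abs x))));
    [reflexivity | lia].
Qed.

Lemma l2_le_0 f : l2_le f 0 -> forall x, f x = C0.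
Proof.
intros H x; apply Cnorm2_eq0; pose proof (l2_le_point f 0 x H).
pose proof (Cnorm2_nonneg (f x)); lra.
Qed.

Lemma l2_le_zero f m : 0 <= m -> (forall x, f x = C0) -> l2_le f m.
Proof.
intros Hm H; split; [easy |]; intro n.
rewrite (wsum_ext _ (fun x => 0 * 0)); [rewrite wsum_scal; nra |].
intros; rewrite H, Cnorm2_C0; ring.
Qed.

(** Minkowski's inequality. For positive [a] and [b] it is the sum over the window of [|u + v|^2 <=
    (1 + b/a) |u|^2 + (1 + a/b) |v|^2], multiplied by [a b] to avoid quotients; a zero bound means a
    zero sequence. *)
Lemma l2_le_add f g a b :
  l2_le f a -> l2_le g b -> l2_le (fun x => f x + g x)%Cx (a + b).
Proof.
intros Hf Hg; pose proof (proj1 Hf); pose proof (proj1 Hg).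
destruct (Req_dec a 0) as [-> | Ha].
{ rewrite Rplus_0_l; apply l2_le_ext with g; [| easy].
  intro x; rewrite (l2_le_0 f Hf x); ring. }
destruct (Req_dec b 0) as [-> | Hb].
{ rewrite Rplus_0_r; apply l2_le_ext with f; [| easy].
  intro x; rewrite (l2_le_0 g Hg x); ring. }
split; [lra |]; intro n.
assert (Hab : 0 < a * b) by nra.
apply Rmult_le_reg_l with (a * b); [easy |].
rewrite <- wsum_scal.
apply Rle_trans with (wsum (fun x => b * (a + b) * Cnorm2 (f x)
   + a * (a + b) * Cnorm2 (g x)) n).
- apply wsum_le; intros x _; destruct (f x) as [u v], (g x) as [s t]; cx_unfold.
  (* The gap between the two sides is [|b f - a g|^2]. *)
  assert (0 <= (b * u - a * s) * (b * u - a * s) + (b * v - a * t) * (b * v - a * t))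
    by (apply Rplus_le_le_0_compat; apply Rle_0_sqr).
  lra.
- rewrite wsum_lin; pose proof (proj2 Hf n); pose proof (proj2 Hg n).
  apply Rle_trans with (b * (a + b) * (a * a) + a * (a + b) * (b * b)); [| right; ring].
  apply Rplus_le_compat; apply Rmult_le_compat_l; nra.
Qed.

Lemma l2_le_scal c f m : l2_le f m -> l2_le (fun x => c * f x)%Cx (Cabs c * m).
Proof.
apply l2_le_dom; [apply Cabs_nonneg |]; intro x; rewrite Cnorm2_mul, Cabs_sqr; lra.
Qed.

Lemma l2_le_sub f g a b :
  l2_le f a -> l2_le g b -> l2_le (fun x => f x - g x)%Cx (a + b).
Proof.
intros Hf Hg; apply (l2_le_add f (fun x => - g x)%Cx); [easy |].
apply l2_le_sub_dom with g; [| easy]; intro x; right; cx_unfold; ring.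
Qed.

Lemma l2_le_neg f m : l2_le f m -> l2_le (fun x => f (- x)%Z) m.
Proof.
intros [H0 H]; split; [easy |]; intro n.
rewrite (wsum_neg (fun x => Cnorm2 (f x))); apply H.
Qed.

(** The window shifted by one fits into the next larger symmetric window. *)
Lemma l2_le_succ f m : l2_le f m -> l2_le (fun x => f (x + 1)%Z) m.
Proof.
intros [H0 H]; split; [easy |]; intro n.
rewrite (wsum_shift (fun x => Cnorm2 (f x))).
pose proof (H (S n)) as h; cbn [wsum] in h.
pose proof (Cnorm2_nonneg (f (- Z.of_nat (S n))%Z)).
pose proof (Cnorm2_nonneg (f (- Z.of_nat n)%Z)).
replace (Z.of_nat n + 1)%Z with (Z.of_nat (S n)) by lia; lra.
Qed.

Lemma l2_le_pred f m : l2_le f m -> l2_le (fun x => f (x - 1)%Z) m.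
Proof.
intro H; apply l2_le_neg, l2_le_succ, l2_le_neg in H.
revert H; apply l2_le_ext; intro x; cbv beta; f_equal; lia.
Qed.

Lemma in_l2_add f g : in_l2 f -> in_l2 g -> in_l2 (fun x => f x + g x)%Cx.
Proof.
intros Hf Hg; destruct (in_l2_l2_le f Hf) as [a Ha], (in_l2_l2_le g Hg) as [b Hb].
exact (l2_le_in_l2 _ _ (l2_le_add f g a b Ha Hb)).
Qed.

Lemma in_l2_scal c f : in_l2 f -> in_l2 (fun x => c * f x)%Cx.
Proof.
intros Hf; destruct (in_l2_l2_le f Hf) as [a Ha].
exact (l2_le_in_l2 _ _ (l2_le_scal c f a Ha)).
Qed.

Lemma in_l2_sub f g : in_l2 f -> in_l2 g -> in_l2 (fun x => f x - g x)%Cx.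
Proof.
intros Hf Hg; destruct (in_l2_l2_le f Hf) as [a Ha], (in_l2_l2_le g Hg) as [b Hb].
exact (l2_le_in_l2 _ _ (l2_le_sub f g a b Ha Hb)).
Qed.

Lemma in_l2_restrict (f g : seqZ) :
  (forall x, g x = f x \/ g x = C0) -> in_l2 f -> in_l2 g.
Proof.
intros H Hf; destruct (in_l2_l2_le f Hf) as [a Ha].
apply l2_le_in_l2 with a, l2_le_sub_dom with f; [| easy].
intro x; destruct (H x) as [-> | ->]; [lra |].
rewrite Cnorm2_C0; apply Cnorm2_nonneg.
Qed.

(** A window whose sum is within [e^2] of the supremum leaves at most [e^2] outside. The cut-off [g]
    is arbitrary so that a single far bump of [f] can be selected later. *)
Lemma l2_tail f e :
  in_l2 f -> 0 < e ->
  exists N : Z, forall g : seqZ, (forall x, (x < N)%Z -> g x = C0) ->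
    (forall x, g x = f x \/ g x = C0) -> l2_le g e.
Proof.
intros Hf He; destruct Hf as [M HM].
destruct (completeness (fun r => exists n, r = wsum (fun x => Cnorm2 (f x)) n))
  as [s [Hs1 Hs2]].
- exists M; intros r [n ->]; rewrite <- partial_norm2_wsum; apply HM.
- now exists (wsum (fun x => Cnorm2 (f x)) 0), 0%nat.
- assert (exists n0, s - e * e < wsum (fun x => Cnorm2 (f x)) n0) as [n0 Hn0].
  { apply NNPP; intro h.
    assert (s <= s - e * e); [| nra].
    apply Hs2; intros r [n ->]; apply Rnot_lt_le; intro; apply h; now exists n. }
  exists (Z.of_nat n0 + 1)%Z; intros g Hg1 Hg2; split; [lra |].
  assert (Hle : forall x, Cnorm2 (g x) <= Cnorm2 (f x)).
  { intro x; destruct (Hg2 x) as [-> | ->]; [lra |].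
    rewrite Cnorm2_C0; apply Cnorm2_nonneg. }
  assert (H0 : wsum (fun x => Cnorm2 (g x)) n0 = 0).
  { rewrite (wsum_ext _ (fun x => 0 * 0)); [rewrite wsum_scal; ring |].
    intros x hx; rewrite Hg1, Cnorm2_C0 by lia; ring. }
  assert (Hdiff : forall n, wsum (fun x => Cnorm2 (g x)) (n0 + n)
     <= wsum (fun x => Cnorm2 (f x)) (n0 + n) - wsum (fun x => Cnorm2 (f x)) n0).
  { induction n as [| n IH]; [rewrite Nat.add_0_r, H0; lra |].
    rewrite Nat.add_succ_r; cbn [wsum].
    pose proof (Hle (Z.of_nat (S (n0 + n)))).
    pose proof (Hle (- Z.of_nat (S (n0 + n)))%Z); lra. }
  intro n; apply Rle_trans with (wsum (fun x => Cnorm2 (g x)) (n0 + n)).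
  + apply wsum_mono; [intro; apply Cnorm2_nonneg | lia].
  + specialize (Hdiff n).
    assert (wsum (fun x => Cnorm2 (f x)) (n0 + n) <= s) by (apply Hs1; eauto).
    lra.
Qed.

(** * Completeness of the complex numbers and of l2(Z) *)

Lemma Cx_complete (c : nat -> Cx) :
  (forall e, 0 < e -> exists n0, forall n m, (n0 <= n)%nat -> (n0 <= m)%nat ->
     Cnorm2 (c n - c m)%Cx <= e * e) ->
  exists l, Un_cv (fun n => fst (c n)) (fst l) /\ Un_cv (fun n => snd (c n)) (snd l).
Proof.
intro H.
assert (H' : forall (pr : Cx -> R),
  (forall z w, (pr z - pr w) * (pr z - pr w) <= Cnorm2 (z - w)%Cx) ->
  exists l, Un_cv (fun n => pr (c n)) l).
{ intros pr Hpr; destruct (R_complete (fun n => pr (c n))) as [l Hl]; [| now exists l].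
  intros e He; destruct (H (e / 2)) as [n0 Hn0]; [lra |].
  exists n0; intros n m Hn Hm; specialize (Hn0 n m Hn Hm).
  specialize (Hpr (c n) (c m)); unfold Rdist.
  set (t := pr (c n) - pr (c m)) in *.
  assert (t * t < e * e) by nra; apply Rabs_def1; nra. }
destruct (H' fst) as [x Hx].
{ intros z w; pose proof (Rle_0_sqr (snd z - snd w)); unfold Rsqr in *; cx_unfold; lra. }
destruct (H' snd) as [y Hy].
{ intros z w; pose proof (Rle_0_sqr (fst z - fst w)); unfold Rsqr in *; cx_unfold; lra. }
now exists (x, y).
Qed.

Lemma Un_cv_Cnorm2_sub (c : nat -> Cx) l z :
  Un_cv (fun n => fst (c n)) (fst l) -> Un_cv (fun n => snd (c n)) (snd l) ->
  Un_cv (fun n => Cnorm2 (z - c n)%Cx) (Cnorm2 (z - l)%Cx).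
Proof.
intros Hx Hy.
assert (Hc : forall r : R, Un_cv (fun _ => r) r).
{ intros r e He; exists 0%nat; intros; unfold Rdist; rewrite Rminus_diag, Rabs_R0; easy. }
assert (H1 := CV_minus _ _ _ _ (Hc (fst z)) Hx).
assert (H2 := CV_minus _ _ _ _ (Hc (snd z)) Hy).
exact (CV_plus _ _ _ _ (CV_mult _ _ _ _ H1 H1) (CV_mult _ _ _ _ H2 H2)).
Qed.

Lemma Un_cv_le (u : nat -> R) l M n0 :
  Un_cv u l -> (forall n, (n0 <= n)%nat -> u n <= M) -> l <= M.
Proof.
intros Hu H; apply Rnot_lt_le; intro h.
destruct (Hu (l - M)) as [n1 Hn1]; [lra |].
specialize (Hn1 (max n0 n1) ltac:(lia)); specialize (H (max n0 n1) ltac:(lia)).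
unfold Rdist in Hn1; apply Rabs_def2 in Hn1; lra.
Qed.

Lemma Un_cv_wsum (u : nat -> Z -> R) (v : Z -> R) n :
  (forall x, Un_cv (fun k => u k x) (v x)) -> Un_cv (fun k => wsum (u k) n) (wsum v n).
Proof.
intro H; induction n as [| n IH]; cbn [wsum]; [apply H |].
exact (CV_plus _ _ _ _ IH (CV_plus _ _ _ _ (H _) (H _))).
Qed.

(** Limits are taken site by site. On each fixed window the Cauchy bound survives the limit in [m],
    and its threshold does not depend on the window. *)
Lemma l2_complete (F : nat -> seqZ) :
  (forall e, 0 < e -> exists n0, forall n m, (n0 <= n)%nat -> (n0 <= m)%nat ->
     l2_le (fun x => F n x - F m x)%Cx e) ->
  exists f, forall e, 0 < e -> exists n0, forall n, (n0 <= n)%nat ->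
     l2_le (fun x => F n x - f x)%Cx e.
Proof.
intro H.
assert (Hpt : forall x, exists l,
  Un_cv (fun n => fst (F n x)) (fst l) /\ Un_cv (fun n => snd (F n x)) (snd l)).
{ intro x; apply Cx_complete; intros e He; destruct (H e He) as [n0 Hn0].
  exists n0; intros n m Hn Hm; exact (l2_le_point _ _ x (Hn0 n m Hn Hm)). }
apply functional_choice in Hpt; destruct Hpt as [f Hf].
exists f; intros e He; destruct (H e He) as [n0 Hn0]; exists n0; intros n Hn.
split; [lra |]; intro N.
apply Un_cv_le with (u := fun m => wsum (fun x => Cnorm2 (F n x - F m x)%Cx) N) (n0 := n0).
- apply (Un_cv_wsum (fun m x => Cnorm2 (F n x - F m x)%Cx)); intro x.
  apply (Un_cv_Cnorm2_sub (fun m => F m x)); apply Hf.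
- intros m Hm; apply (Hn0 n m Hn Hm).
Qed.

(** * Band operators *)

Definition band (A V B : Z -> Cx) (f : seqZ) : seqZ :=
  fun x => (A x * f (x + 1)%Z + V x * f x + B x * f (x - 1)%Z)%Cx.

Lemma band_add A V B f g x :
  band A V B (fun t => f t + g t)%Cx x = (band A V B f x + band A V B g x)%Cx.
Proof. unfold band; ring. Qed.

Lemma band_sub A V B f g x :
  band A V B (fun t => f t - g t)%Cx x = (band A V B f x - band A V B g x)%Cx.
Proof. unfold band; ring. Qed.

Lemma band_scal A V B c f x :
  band A V B (fun t => c * f t)%Cx x = (c * band A V B f x)%Cx.
Proof. unfold band; ring. Qed.

Definition supp_in (P : Z -> Prop) (f : seqZ) : Prop := forall x, ~ P x -> f x = C0.

(** Coefficients are bounded only where they meet the support of [f]. This makes the deviation from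
    the limiting coefficients small for sequences supported far out. *)
Lemma l2_le_band A V B (D : Z -> Prop) f k m :
  0 <= k -> supp_in D f ->
  (forall x, D (x + 1)%Z -> Cnorm2 (A x) <= k * k) ->
  (forall x, D x -> Cnorm2 (V x) <= k * k) ->
  (forall x, D (x - 1)%Z -> Cnorm2 (B x) <= k * k) ->
  l2_le f m -> l2_le (band A V B f) (3 * k * m).
Proof.
intros Hk HD HA HV HB Hf.
assert (Hs : forall (W : Z -> Cx) s, (forall x, D (s x) -> Cnorm2 (W x) <= k * k) ->
  forall x, Cnorm2 (W x * f (s x))%Cx <= k * k * Cnorm2 (f (s x))).
{ intros W s HW x; rewrite Cnorm2_mul.
  destruct (classic (D (s x))) as [h | h].
  - apply Rmult_le_compat_r; [apply Cnorm2_nonneg | now apply HW].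
  - rewrite (HD _ h), Cnorm2_C0; lra. }
replace (3 * k * m) with (k * m + k * m + k * m) by ring.
apply l2_le_add; [apply l2_le_add |].
- apply l2_le_dom with (fun x => f (x + 1)%Z); [easy | | now apply l2_le_succ].
  now apply (Hs A (fun x => x + 1)%Z).
- apply l2_le_dom with f; [easy | | easy]; now apply (Hs V (fun x => x)).
- apply l2_le_dom with (fun x => f (x - 1)%Z); [easy | | now apply l2_le_pred].
  now apply (Hs B (fun x => x - 1)%Z).
Qed.

Definition coef_bound (A V B : Z -> Cx) (k : R) : Prop :=
  0 <= k /\ forall x, Cnorm2 (A x) <= k * k /\ Cnorm2 (V x) <= k * k /\ Cnorm2 (B x) <= k * k.

Lemma l2_le_band_global A V B k f m :
  coef_bound A V B k -> l2_le f m -> l2_le (band A V B f) (3 * k * m).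
Proof.
intros [Hk H] Hf; apply l2_le_band with (fun _ => True); try easy; intros; apply H.
Qed.

Lemma in_l2_band A V B k f :
  coef_bound A V B k -> in_l2 f -> in_l2 (band A V B f).
Proof.
intros H Hf; destruct (in_l2_l2_le f Hf) as [m Hm].
exact (l2_le_in_l2 _ _ (l2_le_band_global A V B k f m H Hm)).
Qed.

(** * Closed range for sequences with prescribed support *)

Definition closed_range_on (P : Z -> Prop) (T : seqZ -> seqZ) : Prop :=
  forall y : seqZ, in_l2 y ->
    (forall e, 0 < e -> exists f, in_l2 f /\ supp_in P f /\ l2_le (fun x => T f x - y x)%Cx e) ->
    exists f, in_l2 f /\ supp_in P f /\ forall x, T f x = y x.

(** This is [||f|| <= K ||T f||], phrased with upper bounds for both norms. *)
Definition bounded_below_on (P : Z -> Prop) (T : seqZ -> seqZ) (K : R) : Prop :=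
  0 < K /\
  forall f, in_l2 f -> supp_in P f -> forall m, l2_le (T f) m -> l2_le f (K * m).

Lemma inv_succ_small e : 0 < e -> exists n0, forall n, (n0 <= n)%nat -> / (INR n + 1) < e.
Proof.
intro He; destruct (archimed_cor1 e He) as [n0 [H1 H2]]; exists n0; intros n Hn.
apply Rlt_trans with (2 := H1).
apply le_INR in Hn; apply lt_INR in H2; simpl in H2.
apply Rinv_lt_contravar; nra.
Qed.

Lemma l2_le_all_zero f : (forall e, 0 < e -> l2_le f e) -> forall x, f x = C0.
Proof.
intros H x; apply Cnorm2_eq0, Rle_antisym; [| apply Cnorm2_nonneg].
apply Rnot_lt_le; intro h.
assert (h' : 0 < sqrt (Cnorm2 (f x) / 2)) by (apply sqrt_lt_R0; lra).
pose proof (l2_le_point _ _ x (H _ h')) as h2; rewrite sqrt_sqrt in h2 by lra; lra.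
Qed.

(** The lower bound makes approximate preimages of [y] a Cauchy sequence; their limit keeps the
    support, and boundedness of the operator identifies its image with [y]. *)
Lemma bounded_below_closed A V B k P K :
  coef_bound A V B k ->
  bounded_below_on P (band A V B) K -> closed_range_on P (band A V B).
Proof.
intros Hk [HK HB] y Hy H.
assert (Hch : forall n : nat, exists f, in_l2 f /\ supp_in P f /\
  l2_le (fun x => band A V B f x - y x)%Cx (/ (INR n + 1))).
{ intro n; apply H, Rinv_0_lt_compat; pose proof (pos_INR n); lra. }
apply functional_choice in Hch; destruct Hch as [F HF].
destruct (l2_complete F) as [f Hf].
{ intros e He; destruct (inv_succ_small (e / (2 * K))) as [n0 Hn0].
  { apply Rdiv_lt_0_compat; lra. }
  exists n0; intros n m Hn Hm.
  destruct (HF n) as [Fn1 [Fn2 Fn3]], (HF m) as [Fm1 [Fm2 Fm3]].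
  apply l2_le_weaken with (K * (/ (INR n + 1) + / (INR m + 1))).
  { pose proof (Hn0 n Hn); pose proof (Hn0 m Hm).
    replace e with (K * (e / (2 * K) + e / (2 * K))) by (field; lra).
    apply Rmult_le_compat_l; lra. }
  apply HB.
  - now apply in_l2_sub.
  - intros x hx; rewrite Fn2, Fm2 by easy; ring.
  - generalize (l2_le_sub _ _ _ _ Fn3 Fm3); apply l2_le_ext.
    intro x; rewrite band_sub; ring. }
exists f; split; [| split].
- destruct (Hf 1 Rlt_0_1) as [n0 Hn0]; specialize (Hn0 n0 (le_n _)).
  apply l2_le_in_l2 in Hn0; destruct (HF n0) as [F1 _].
  generalize (in_l2_sub _ _ F1 Hn0); apply in_l2_restrict; intro x; left; ring.
- intros x hx.
  (* Isolates the site [x]: the approximants vanish there, so the cut-off limit has arbitrarily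
     small norm. *)
  set (g := fun t => if Z.eq_dec t x then f t else C0).
  replace (f x) with (g x) by (unfold g; destruct (Z.eq_dec x x); easy).
  apply l2_le_all_zero; intros e He; destruct (Hf e He) as [n0 Hn0].
  generalize (Hn0 n0 (le_n _)); apply l2_le_sub_dom; intro t; unfold g.
  destruct (Z.eq_dec t x) as [-> |].
  + destruct (HF n0) as [_ [F2 _]]; rewrite (F2 x hx); right; cx_unfold; ring.
  + rewrite Cnorm2_C0; apply Cnorm2_nonneg.
- intro x.
  assert (Hz : (band A V B f x - y x)%Cx = C0).
  { apply (l2_le_all_zero (fun x => band A V B f x - y x)%Cx); intros e He.
    pose proof (proj1 Hk).
    (* The operator norm is at most [3 k], so this error contributes at most [e / 2]; [k + 1] avoids
       division by zero. *)
    destruct (Hf (e / (6 * (k + 1)))) as [n1 Hn1]; [apply Rdiv_lt_0_compat; lra |].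
    destruct (inv_succ_small (e / 2)) as [n2 Hn2]; [lra |].
    specialize (Hn1 (max n1 n2) ltac:(lia)); specialize (Hn2 (max n1 n2) ltac:(lia)).
    destruct (HF (max n1 n2)) as [_ [_ F3]].
    apply (l2_le_band_global A V B k) in Hn1; [| easy].
    generalize (l2_le_sub _ _ _ _ F3 Hn1); intro h.
    eapply l2_le_weaken in h; [revert h; apply l2_le_ext; intro t; rewrite band_sub; ring |].
    apply Rle_trans with (e / 2 + 3 * (k + 1) * (e / (6 * (k + 1)))); [| right; field; lra].
    assert (0 < e / (6 * (k + 1))) by (apply Rdiv_lt_0_compat; lra); nra. }
  replace (band A V B f x) with ((band A V B f x - y x) + y x)%Cx by ring.
  rewrite Hz; ring.
Qed.

Definition delta (x0 : Z) : seqZ := fun x => if Z.eq_dec x x0 then Cone else C0.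

Lemma in_l2_delta x0 : in_l2 (delta x0).
Proof.
apply l2_le_in_l2 with 1; split; [lra |]; intro n.
rewrite (wsum_ext _ (fun x => if (x =? x0)%Z then 1 else 0)).
- rewrite wsum_point; destruct (Z.leb (Z.abs x0) (Z.of_nat n)); lra.
- intros x _; unfold delta; destruct (Z.eq_dec x x0), (Z.eqb_spec x x0); try easy.
  + apply Cnorm2_Cone.
  + apply Cnorm2_C0.
Qed.

Lemma Cx_limit (c : nat -> Cx) :
  (forall e, 0 < e -> exists n0, forall n m, (n0 <= n)%nat -> (n0 <= m)%nat ->
     Cabs (c n - c m)%Cx <= e) ->
  exists l, forall e, 0 < e -> exists n0, forall n, (n0 <= n)%nat -> Cabs (c n - l)%Cx <= e.
Proof.
intro H; destruct (Cx_complete c) as [l [H1 H2]].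
{ intros e He; destruct (H e He) as [n0 Hn0]; exists n0; intros n m Hn Hm.
  rewrite <- Cabs_sqr; specialize (Hn0 n m Hn Hm).
  pose proof (Cabs_nonneg (c n - c m)%Cx); nra. }
exists l; intros e He; destruct (H e He) as [n0 Hn0]; exists n0; intros n Hn.
unfold Cabs; rewrite <- (sqrt_square e) by lra; apply sqrt_le_1_alt.
apply Un_cv_le with (u := fun m => Cnorm2 (c n - c m)%Cx) (n0 := n0).
- now apply Un_cv_Cnorm2_sub.
- intros m Hm; rewrite <- Cabs_sqr; specialize (Hn0 n m Hn Hm).
  pose proof (Cabs_nonneg (c n - c m)%Cx); nra.
Qed.

(* A closed subspace plus a line is closed: if the image e of the new basis vector is not
   in the closed subspace, it has positive distance from it, so the coefficients of e along
   any convergent sequence are Cauchy. *)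
Lemma closed_range_on_cons A V B k P x0 :
  coef_bound A V B k ->
  closed_range_on P (band A V B) ->
  closed_range_on (fun x => x = x0 \/ P x) (band A V B).
Proof.
intros Hk HP y Hy H.
set (T := band A V B) in *; set (e0 := T (delta x0)).
assert (He0 : in_l2 e0) by exact (in_l2_band _ _ _ k _ Hk (in_l2_delta x0)).
assert (Hsplit : forall f, in_l2 f -> supp_in (fun x => x = x0 \/ P x) f ->
  exists c g, in_l2 g /\ supp_in P g /\ forall x, f x = (g x + c * delta x0 x)%Cx).
{ intros f Hf1 Hf2.
  exists (f x0), (fun x => if Z.eq_dec x x0 then C0 else f x); split; [| split].
  - revert Hf1; apply in_l2_restrict; intro x; destruct (Z.eq_dec x x0); auto.
  - intros x hx; destruct (Z.eq_dec x x0) as [| h]; [easy |].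
    apply Hf2; tauto.
  - intro x; unfold delta; destruct (Z.eq_dec x x0) as [-> |]; ring. }
assert (HT : forall f g c x, (forall t, f t = (g t + c * delta x0 t)%Cx) ->
  T f x = (T g x + c * e0 x)%Cx).
{ intros f g c x hf; unfold e0, T, band; rewrite !hf; ring. }
(* If [e0] is already the image of some [h] supported in [P], then [h] replaces [delta x0] and the
   new coordinate adds nothing to the range. *)
destruct (classic (exists f, in_l2 f /\ supp_in P f /\ forall x, T f x = e0 x))
  as [[h [Hh1 [Hh2 Hh3]]] | Hno].
- destruct (HP y Hy) as [f [Hf1 [Hf2 Hf3]]].
  + intros e He; destruct (H e He) as [f [Hf1 [Hf2 Hf3]]].
    destruct (Hsplit f Hf1 Hf2) as [c [g [Hg1 [Hg2 Hg3]]]].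
    exists (fun x => g x + c * h x)%Cx; split; [| split].
    * apply in_l2_add, in_l2_scal; easy.
    * intros x hx; rewrite Hg2, Hh2 by easy; ring.
    * revert Hf3; apply l2_le_ext; intro x; rewrite (HT f g c x Hg3), <- Hh3.
      unfold T; rewrite band_add, band_scal; ring.
  + exists f; split; [easy | split; [| easy]].
    intros x hx; apply Hf2; tauto.
- assert (exists d, 0 < d /\ forall g, in_l2 g -> supp_in P g ->
    ~ l2_le (fun x => T g x - e0 x)%Cx d) as [d [Hd Hdist]].
  { apply NNPP; intro h; apply Hno, HP; [easy |].
    intros e He; apply NNPP; intro h2; apply h; exists e; split; [easy |].
    intros g Hg1 Hg2 Hg3; apply h2; now exists g. }
  (* Dividing by [- c] turns [T g + c * e0] into a difference from [e0], to which the distance [d]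
     applies. *)
  assert (Hdist2 : forall g c m, in_l2 g -> supp_in P g ->
    l2_le (fun x => T g x + c * e0 x)%Cx m -> Cabs c * d <= m).
  { intros g c m Hg1 Hg2 Hm; apply Rnot_lt_le; intro h.
    assert (Hc : c <> C0).
    { intros ->; unfold Cabs in h; rewrite Cnorm2_C0, sqrt_0 in h.
      pose proof (proj1 Hm); lra. }
    pose proof (Cabs_pos c Hc) as Hc'.
    apply (Hdist (fun x => (- Cinv c) * g x)%Cx).
    - now apply in_l2_scal.
    - intros x hx; rewrite Hg2 by easy; ring.
    - apply l2_le_weaken with (/ Cabs c * m).
      { apply Rmult_le_reg_l with (Cabs c); [easy |].
        rewrite <- Rmult_assoc, Rinv_r by lra; lra. }
      apply l2_le_dom with (3 := Hm); [apply Rlt_le, Rinv_0_lt_compat; easy |].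
      intro x; unfold T; rewrite band_scal; fold T.
      replace ((- Cinv c) * T g x - e0 x)%Cx with ((- Cinv c) * (T g x + c * e0 x))%Cx.
      + rewrite Cnorm2_mul; right; f_equal.
        rewrite <- Rinv_mult, Cabs_sqr; pose proof (Cnorm2_pos c Hc).
        unfold Cinv; destruct c as [u v]; cx_unfold; field; lra.
      + replace (- Cinv c * (T g x + c * e0 x))%Cx
          with (- Cinv c * T g x - (c * Cinv c) * e0 x)%Cx by ring.
        rewrite Cmul_inv by easy; ring. }
  assert (Hch : forall n : nat, exists cg : Cx * seqZ, in_l2 (snd cg) /\ supp_in P (snd cg) /\
    l2_le (fun x => T (snd cg) x + fst cg * e0 x - y x)%Cx (/ (INR n + 1))).
  { intro n; destruct (H (/ (INR n + 1))) as [f [Hf1 [Hf2 Hf3]]].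
    { apply Rinv_0_lt_compat; pose proof (pos_INR n); lra. }
    destruct (Hsplit f Hf1 Hf2) as [c [g [Hg1 [Hg2 Hg3]]]].
    exists (c, g); split; [easy | split; [easy |]].
    revert Hf3; apply l2_le_ext; intro x; simpl; now rewrite (HT f g c x Hg3). }
  apply functional_choice in Hch; destruct Hch as [F HF].
  destruct (Cx_limit (fun n => fst (F n))) as [l Hl].
  { intros e He; destruct (inv_succ_small (e * d / 2)) as [n0 Hn0]; [nra |].
    exists n0; intros n m Hn Hm.
    destruct (HF n) as [Fn1 [Fn2 Fn3]], (HF m) as [Fm1 [Fm2 Fm3]].
    apply Rmult_le_reg_r with d; [easy |].
    apply Rle_trans with (/ (INR n + 1) + / (INR m + 1)).
    - apply Hdist2 with (fun x => snd (F n) x - snd (F m) x)%Cx.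
      + now apply in_l2_sub.
      + intros x hx; rewrite Fn2, Fm2 by easy; ring.
      + generalize (l2_le_sub _ _ _ _ Fn3 Fm3); apply l2_le_ext; intro x.
        unfold T; rewrite band_sub; ring.
    - pose proof (Hn0 n Hn); pose proof (Hn0 m Hm); lra. }
  destruct (in_l2_l2_le e0 He0) as [m0 Hm0].
  destruct (HP (fun x => y x - l * e0 x)%Cx) as [g [Hg1 [Hg2 Hg3]]].
  + apply in_l2_sub; [easy | now apply in_l2_scal].
  + intros e He; pose proof (proj1 Hm0).
    (* The bound [m0] on the norm of [e0] may be zero, hence [m0 + 1]. *)
    destruct (Hl (e / (2 * (m0 + 1)))) as [n1 Hn1]; [apply Rdiv_lt_0_compat; lra |].
    destruct (inv_succ_small (e / 2)) as [n2 Hn2]; [lra |].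
    specialize (Hn1 (max n1 n2) ltac:(lia)); specialize (Hn2 (max n1 n2) ltac:(lia)).
    destruct (HF (max n1 n2)) as [F1 [F2 F3]].
    exists (snd (F (max n1 n2))); split; [easy | split; [easy |]].
    set (n := max n1 n2) in *.
    apply l2_le_weaken with (/ (INR n + 1) + Cabs (fst (F n) - l)%Cx * m0).
    * apply Rle_trans with (e / 2 + e / (2 * (m0 + 1)) * (m0 + 1)); [| right; field; lra].
      assert (0 < e / (2 * (m0 + 1))) by (apply Rdiv_lt_0_compat; lra).
      pose proof (Cabs_nonneg (fst (F n) - l)%Cx); nra.
    * generalize (l2_le_sub _ _ _ _ F3 (l2_le_scal (fst (F n) - l)%Cx _ _ Hm0)).
      apply l2_le_ext; intro x; ring.
  + exists (fun x => g x + l * delta x0 x)%Cx; split; [| split].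
    * apply in_l2_add, in_l2_scal, in_l2_delta; easy.
    * intros x hx; rewrite Hg2 by tauto; unfold delta.
      destruct (Z.eq_dec x x0); [tauto | ring].
    * intro x; rewrite (HT _ g l x); [rewrite Hg3; ring | easy].
Qed.

Lemma closed_range_on_app A V B k P l :
  coef_bound A V B k -> closed_range_on P (band A V B) ->
  closed_range_on (fun x => In x l \/ P x) (band A V B).
Proof.
intros Hk HP; induction l as [| x0 l IH].
- intros y Hy H; destruct (HP y Hy) as [f [H1 [H2 H3]]].
  + intros e He; destruct (H e He) as [f [H1 [H2 H3]]]; exists f; split; [| split]; auto.
    intros x hx; apply H2; simpl; tauto.
  + exists f; split; [| split]; auto; intros x hx; apply H2; tauto.
- intros y Hy H.
  destruct (closed_range_on_cons A V B k _ x0 Hk IH y Hy) as [f [H1 [H2 H3]]].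
  + intros e He; destruct (H e He) as [f [H1 [H2 H3]]]; exists f; split; [| split]; auto.
    intros x hx; apply H2; simpl; intros [[h | h] | h]; apply hx; auto.
  + exists f; split; [| split]; auto; intros x hx; apply H2; simpl in *; firstorder.
Qed.

(** Coordinates outside [P] only multiply vanishing columns, so cutting them off leaves the image
    unchanged. *)
Lemma closed_range_of_on A V B P :
  closed_range_on P (band A V B) ->
  (forall x, P x \/ (A (x - 1)%Z = C0 /\ V x = C0 /\ B (x + 1)%Z = C0)) ->
  closed_range (band A V B).
Proof.
intros HP Hcol y Hy H.
destruct (HP y Hy) as [f [H1 [H2 H3]]].
- intros e He; destruct (H e He) as [f [H1 H2]].
  apply l2_norm_lt_iff in H2; [| easy]; destruct H2 as [m [Hm H2]].
  exists (fun x => if excluded_middle_informative (P x) then f x else C0); split; [| split].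
  + revert H1; apply in_l2_restrict; intro x.
    destruct (excluded_middle_informative (P x)); auto.
  + intros x hx; destruct (excluded_middle_informative (P x)); easy.
  + apply l2_le_weaken with m; [lra |]; revert H2; apply l2_le_ext; intro x.
    unfold seq_sub; f_equal; unfold band.
    f_equal; [f_equal |].
    * destruct (excluded_middle_informative (P (x + 1)%Z)) as [| h]; [easy |].
      destruct (Hcol (x + 1)%Z) as [| [h' _]]; [easy |].
      replace (x + 1 - 1)%Z with x in h' by lia; rewrite h'; ring.
    * destruct (excluded_middle_informative (P x)) as [| h]; [easy |].
      destruct (Hcol x) as [| [_ [h' _]]]; [easy |]; rewrite h'; ring.
    * destruct (excluded_middle_informative (P (x - 1)%Z)) as [| h]; [easy |].
      destruct (Hcol (x - 1)%Z) as [| [_ [_ h']]]; [easy |].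
      replace (x - 1 + 1)%Z with x in h' by lia; rewrite h'; ring.
- exists f; split; [easy |]; now apply functional_extensionality.
Qed.

(** * Bounds from below and closed range *)

(** Let [s] be the norm of [f]. For [|z| < 1], solving for [f (x + 1)] gives [s <= m + |z| s]; for
    [|z| > 1], solving for [z f x] gives [|z| s <= s + m]. The shift preserves the norm in both
    cases. *)
Lemma first_order_bounded_below z f m :
  in_l2 f -> Cabs z <> 1 -> l2_le (fun x => f (x + 1)%Z - z * f x)%Cx m ->
  l2_le f (/ Rabs (1 - Cabs z) * m).
Proof.
intros Hf Hz Hm; destruct (l2_norm_exists f Hf) as [s [Hs Hmin]].
apply l2_le_weaken with s; [| easy].
assert (Hpos : 0 < Rabs (1 - Cabs z)) by (apply Rabs_pos_lt; lra).
apply Rmult_le_reg_l with (Rabs (1 - Cabs z)); [easy |].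
rewrite <- Rmult_assoc, Rinv_r, Rmult_1_l by lra.
destruct (Rlt_le_dec (Cabs z) 1) as [h | h].
- rewrite Rabs_pos_eq by lra.
  assert (s <= m + Cabs z * s); [| lra].
  apply Hmin; generalize (l2_le_pred _ _ (l2_le_add _ _ _ _ Hm (l2_le_scal z _ _ Hs))).
  apply l2_le_ext; intro x; cbv beta.
  replace (x - 1 + 1)%Z with x by lia; ring.
- rewrite Rabs_left1 by lra.
  assert (s <= / Cabs z * (s + m)) as h2.
  { apply Hmin.
    apply l2_le_dom with (3 := l2_le_sub _ _ _ _ (l2_le_succ _ _ Hs) Hm).
    - apply Rlt_le, Rinv_0_lt_compat; lra.
    - intro x; right; rewrite <- Rinv_mult, Cabs_sqr.
      replace (f (x + 1)%Z - (f (x + 1)%Z - z * f x))%Cx with (z * f x)%Cx by ring.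
      rewrite Cnorm2_mul; field; rewrite <- Cabs_sqr; nra. }
  apply Rmult_le_compat_l with (r := Cabs z) in h2; [| lra].
  rewrite <- Rmult_assoc, Rinv_r in h2 by lra; lra.
Qed.

Definition const_band (a v b : Cx) : seqZ -> seqZ :=
  band (fun _ => a) (fun _ => v) (fun _ => b).

Definition everywhere (x : Z) : Prop := True.

(* The symbol [a z + v + b / z] is [a (z - z1) (1 - z2 / z)]. *)
Lemma const_band_bounded_below a v b z1 z2 :
  a <> C0 -> Cabs z1 <> 1 -> Cabs z2 <> 1 ->
  v = (- (a * (z1 + z2)))%Cx -> b = (a * (z1 * z2))%Cx ->
  exists K, bounded_below_on everywhere (const_band a v b) K.
Proof.
intros Ha H1 H2 -> ->.
assert (Ha' := Cabs_pos a Ha).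
assert (Hp : forall z, Cabs z <> 1 -> 0 < / Rabs (1 - Cabs z)).
{ intros z Hz; apply Rinv_0_lt_compat, Rabs_pos_lt; lra. }
pose proof (Hp z1 H1); pose proof (Hp z2 H2).
exists (/ Rabs (1 - Cabs z2) * (/ Rabs (1 - Cabs z1) * / Cabs a)); split.
{ repeat apply Rmult_lt_0_compat; auto using Rinv_0_lt_compat. }
intros f Hf _ m Hm.
assert (Hf' : in_l2 (fun x => f (x - 1)%Z)).
{ destruct (in_l2_l2_le f Hf) as [s Hs]; exact (l2_le_in_l2 _ _ (l2_le_pred _ _ Hs)). }
(* The inner factor applied to [f]. The outer factor bounds [g] by the image, then the inner one
   bounds [f] by [g]. *)
set (g := fun x => (f x - z2 * f (x - 1)%Z)%Cx).
assert (Hg : l2_le g (/ Rabs (1 - Cabs z1) * (/ Cabs a * m))).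
{ apply first_order_bounded_below; [| easy |].
  - apply in_l2_sub, in_l2_scal; easy.
  - apply l2_le_dom with (3 := Hm); [apply Rlt_le, Rinv_0_lt_compat; easy |].
    intro x; right.
    replace (const_band _ _ _ f x) with (a * (g (x + 1)%Z - z1 * g x))%Cx.
    + rewrite (Cnorm2_mul a), <- Rinv_mult, Cabs_sqr; field.
      pose proof (Cnorm2_pos a Ha); lra.
    + unfold g, const_band, band.
      replace (x + 1 - 1)%Z with x by lia; ring. }
rewrite !Rmult_assoc; apply first_order_bounded_below; [easy | easy |].
generalize (l2_le_succ _ _ Hg); apply l2_le_ext; intro x; unfold g.
now replace (x + 1 - 1)%Z with x by lia.
Qed.

Lemma scalar_bounded_below v :
  v <> C0 -> exists K, bounded_below_on everywhere (const_band C0 v C0) K.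
Proof.
intro Hv; pose proof (Cabs_pos v Hv); pose proof (Cnorm2_pos v Hv); exists (/ Cabs v); split.
{ now apply Rinv_0_lt_compat. }
intros f Hf _ m Hm.
apply l2_le_dom with (3 := Hm); [apply Rlt_le, Rinv_0_lt_compat; easy |].
intro x; right; replace (const_band _ _ _ f x) with (v * f x)%Cx.
- rewrite Cnorm2_mul, <- Rinv_mult, Cabs_sqr; field; lra.
- unfold const_band, band; ring.
Qed.

(** On sequences supported in [D] the perturbation has norm at most [3 d], so
    [s <= K m + 3 d K s <= K m + s / 2] for the norm [s] of [f]. *)
Lemma bounded_below_perturb A V B a v b K d (D : Z -> Prop) :
  bounded_below_on everywhere (const_band a v b) K ->
  0 <= d -> 6 * d * K <= 1 ->
  (forall x, D (x + 1)%Z -> Cabs (A x - a)%Cx <= d) ->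
  (forall x, D x -> Cabs (V x - v)%Cx <= d) ->
  (forall x, D (x - 1)%Z -> Cabs (B x - b)%Cx <= d) ->
  bounded_below_on D (band A V B) (2 * K).
Proof.
intros [HK H] Hd HdK HA HV HB; split; [lra |].
intros f Hf HD m Hm; destruct (l2_norm_exists f Hf) as [s [Hs Hmin]].
apply l2_le_weaken with s; [| easy].
assert (Hsq : forall z, Cabs z <= d -> Cnorm2 z <= d * d).
{ intros z Hz; rewrite <- Cabs_sqr; pose proof (Cabs_nonneg z); nra. }
assert (s <= K * (m + 3 * d * s)).
{ apply Hmin, H; [easy | now intros x [] |].
  assert (Hp : l2_le (band (fun x => A x - a) (fun x => V x - v) (fun x => B x - b) f)%Cx
    (3 * d * s)) by (apply l2_le_band with D; auto).
  generalize (l2_le_sub _ _ _ _ Hm Hp); apply l2_le_ext; intro x.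
  unfold const_band, band; ring. }
pose proof (proj1 Hs); nra.
Qed.

(** These three entries, in rows [x - 1], [x] and [x + 1], make up the image of [delta x]. *)
Definition zero_column (A V B : Z -> Cx) (x : Z) : Prop :=
  A (x - 1)%Z = C0 /\ V x = C0 /\ B (x + 1)%Z = C0.

(** [P] will be a far half line or empty, the latter when the operator vanishes far out. Starting at
    [2] keeps the image in the positive rows, apart from the image of the left end. *)
Definition right_end_ok (A V B : Z -> Cx) : Prop :=
  exists (N : Z) (P : Z -> Prop) (K : R),
    (forall x, P x -> (2 <= x)%Z) /\ bounded_below_on P (band A V B) K /\
    forall x, (N <= x)%Z -> P x \/ zero_column A V B x.

Definition left_end_ok (A V B : Z -> Cx) : Prop :=
  exists (N : Z) (P : Z -> Prop) (K : R),
    (forall x, P x -> (x <= -2)%Z) /\ bounded_below_on P (band A V B) K /\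
    forall x, (x <= N)%Z -> P x \/ zero_column A V B x.

Lemma bounded_below_empty T : bounded_below_on (fun _ => False) T 1.
Proof.
split; [lra |]; intros f _ Hf m [Hm _]; rewrite Rmult_1_l.
apply l2_le_zero; [easy |]; intro x; apply Hf; tauto.
Qed.

Lemma right_end_ok_zero A V B N :
  (forall x, (N <= x)%Z -> zero_column A V B x) -> right_end_ok A V B.
Proof.
intro H; exists N, (fun _ => False), 1; split; [easy | split; [apply bounded_below_empty |]].
auto.
Qed.

Lemma left_end_ok_zero A V B N :
  (forall x, (x <= N)%Z -> zero_column A V B x) -> left_end_ok A V B.
Proof.
intro H; exists N, (fun _ => False), 1; split; [easy | split; [apply bounded_below_empty |]].
auto.
Qed.

Lemma right_end_ok_limit A V B a v b K :
  lim_right_C A a -> lim_right_C V v -> lim_right_C B b ->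
  bounded_below_on everywhere (const_band a v b) K -> right_end_ok A V B.
Proof.
intros HA HV HB HK; pose proof (proj1 HK) as K0.
assert (Hd : 0 < / (6 * K)) by (apply Rinv_0_lt_compat; lra).
destruct (HA _ Hd) as [N1 H1], (HV _ Hd) as [N2 H2], (HB _ Hd) as [N3 H3].
(* [A x] multiplies the value at [x + 1], so sites from [N] on involve [A] from [N - 1] on; hence
   [N1 + 1]. *)
set (N := Z.max 2 (Z.max (N1 + 1) (Z.max N2 N3))).
exists N, (fun x => (N <= x)%Z), (2 * K); split; [intros; lia | split; [| auto]].
apply bounded_below_perturb with a v b (/ (6 * K)); try easy; [lra | right; field; lra | | |];
  intros x hx; apply Rlt_le; [apply H1 | apply H2 | apply H3]; lia.
Qed.

Lemma left_end_ok_limit A V B a v b K :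
  lim_left_C A a -> lim_left_C V v -> lim_left_C B b ->
  bounded_below_on everywhere (const_band a v b) K -> left_end_ok A V B.
Proof.
intros HA HV HB HK; pose proof (proj1 HK) as K0.
assert (Hd : 0 < / (6 * K)) by (apply Rinv_0_lt_compat; lra).
destruct (HA _ Hd) as [N1 H1], (HV _ Hd) as [N2 H2], (HB _ Hd) as [N3 H3].
set (N := Z.min (-2) (Z.min N1 (Z.min N2 (N3 - 1)))).
exists N, (fun x => (x <= N)%Z), (2 * K); split; [intros; lia | split; [| auto]].
apply bounded_below_perturb with a v b (/ (6 * K)); try easy; [lra | right; field; lra | | |];
  intros x hx; apply Rlt_le; [apply H1 | apply H2 | apply H3]; lia.
Qed.

(** No mass sits at [-1], [0], [1], so the images of the left and right halves of [f] occupy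
    disjoint rows. Each is a restriction of the image of [f] and inherits its bound [m]. *)
Lemma bounded_below_union A V B PL PR KL KR :
  (forall x, PL x -> (x <= -2)%Z) -> (forall x, PR x -> (2 <= x)%Z) ->
  bounded_below_on PL (band A V B) KL -> bounded_below_on PR (band A V B) KR ->
  bounded_below_on (fun x => PL x \/ PR x) (band A V B) (KL + KR).
Proof.
intros HL HR [KL0 BL] [KR0 BR]; split; [lra |]; intros f Hf Hs m Hm.
set (fL := fun x => if Z_lt_dec x 0 then f x else C0).
set (fR := fun x => if Z_lt_dec x 0 then C0 else f x).
assert (f0 : forall x, (-2 < x < 2)%Z -> f x = C0).
{ intros x hx; apply Hs; intros [h | h]; [apply HL in h | apply HR in h]; lia. }
assert (Hres : forall g : seqZ, (forall x, g x = band A V B f x \/ g x = C0) -> l2_le g m).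
{ intros g Hg; apply l2_le_sub_dom with (2 := Hm); intro x.
  destruct (Hg x) as [-> | ->]; [lra | rewrite Cnorm2_C0; apply Cnorm2_nonneg]. }
rewrite Rmult_plus_distr_r.
apply l2_le_ext with (fun x => fL x + fR x)%Cx.
{ intro x; unfold fL, fR; destruct (Z_lt_dec x 0); ring. }
apply l2_le_add; [apply BL | apply BR].
- revert Hf; apply in_l2_restrict; intro x; unfold fL; destruct (Z_lt_dec x 0); auto.
- intros x hx; unfold fL; destruct (Z_lt_dec x 0); [| easy].
  apply Hs; intros [h | h]; [easy | apply HR in h; lia].
- apply Hres; intro x; unfold fL, band.
  destruct (Z_lt_dec (x + 1) 0), (Z_lt_dec x 0), (Z_lt_dec (x - 1) 0); try lia.
  + now left.
  + left; rewrite (f0 (x + 1)%Z) by lia; ring.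
  + right; rewrite (f0 (x - 1)%Z) by lia; ring.
  + right; ring.
- revert Hf; apply in_l2_restrict; intro x; unfold fR; destruct (Z_lt_dec x 0); auto.
- intros x hx; unfold fR; destruct (Z_lt_dec x 0); [easy |].
  apply Hs; intros [h | h]; [apply HL in h; lia | easy].
- apply Hres; intro x; unfold fR, band.
  destruct (Z_lt_dec (x + 1) 0), (Z_lt_dec x 0), (Z_lt_dec (x - 1) 0); try lia.
  + right; ring.
  + right; rewrite (f0 (x + 1)%Z) by lia; ring.
  + left; rewrite (f0 (x - 1)%Z) by lia; ring.
  + now left.
Qed.

(** Only the finitely many sites between the two thresholds are added to the supports of the ends;
    every other site is a zero column. *)
Lemma closed_range_of_ends A V B k :
  coef_bound A V B k -> left_end_ok A V B -> right_end_ok A V B ->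
  closed_range (band A V B).
Proof.
intros Hk [NL [PL [KL [HL1 [HL2 HL3]]]]] [NR [PR [KR [HR1 [HR2 HR3]]]]].
set (n := Z.to_nat (NR - NL)).
apply closed_range_of_on with
  (fun x => In x (map (fun i => NL + Z.of_nat i)%Z (List.seq 0 n)) \/ (PL x \/ PR x)).
- apply closed_range_on_app with k; [easy |].
  apply bounded_below_closed with k (KL + KR); [easy |].
  now apply bounded_below_union.
- intro x; destruct (Z_le_dec x NL) as [h | h].
  { destruct (HL3 x h); auto. }
  destruct (Z_le_dec NR x) as [h' | h'].
  { destruct (HR3 x h'); auto. }
  left; left; apply in_map_iff; exists (Z.to_nat (x - NL)); split; [lia |].
  apply in_seq; unfold n; lia.
Qed.

(** * Approximate kernel vectors escaping to infinity *)

Fixpoint Cpow (z : Cx) (n : nat) : Cx :=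
  match n with O => Cone | S m => (z * Cpow z m)%Cx end.

Lemma Cnorm2_pow z n : Cnorm2 z = 1 -> Cnorm2 (Cpow z n) = 1.
Proof.
intro Hz; induction n as [| n IH]; simpl; [apply Cnorm2_Cone |].
rewrite Cnorm2_mul, Hz, IH; ring.
Qed.

Definition box (N : Z) (m : nat) (s : R) (x : Z) : R :=
  if (andb (N <=? x) (x <? N + Z.of_nat m))%Z then s else 0.

Lemma box_out N m s x : (x < N)%Z \/ (N + Z.of_nat m <= x)%Z -> box N m s x = 0.
Proof.
intro H; unfold box; destruct (Z.leb_spec N x), (Z.ltb_spec x (N + Z.of_nat m)); try easy; lia.
Qed.

Lemma wsum_box N m s n :
  (Z.abs N + Z.of_nat m <= Z.of_nat n)%Z -> wsum (box N m s) n = INR m * s.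
Proof.
induction m as [| m IH]; intro H.
- rewrite (wsum_ext _ (fun x => 0 * 0)); [rewrite wsum_scal; simpl; ring |].
  intros x _; rewrite box_out by lia; ring.
- rewrite (wsum_ext _ (fun x => 1 * box N m s x
     + 1 * (if (x =? N + Z.of_nat m)%Z then s else 0))).
  + rewrite wsum_lin, IH, wsum_point, S_INR by lia.
    destruct (Z.leb_spec (Z.abs (N + Z.of_nat m)) (Z.of_nat n)); [ring | lia].
  + intros x _; unfold box; destruct (Z.leb_spec N x), (Z.ltb_spec x (N + Z.of_nat m)),
      (Z.ltb_spec x (N + Z.of_nat (S m))), (Z.eqb_spec x (N + Z.of_nat m)); simpl; try lia; ring.
Qed.

Lemma box_sqr N m s x : box N m s x * box N m s x = box N m (s * s) x.
Proof. unfold box; destruct (andb (N <=? x) (x <? N + Z.of_nat m))%Z; ring. Qed.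

(** Only the two jumps of the box contribute, at [N - 1] and [N + m - 1], each at most [s^2]. *)
Lemma l2_le_box_diff N m s :
  0 <= s -> l2_le (fun x => RtoC (box N m s (x + 1) - box N m s x)) (2 * s).
Proof.
intro Hs; split; [lra |]; intro n.
apply Rle_trans with (wsum (fun x => 1 * (if (x =? N - 1)%Z then s * s else 0)
  + 1 * (if (x =? N + Z.of_nat m - 1)%Z then s * s else 0)) n).
- apply wsum_le; intros x _; rewrite Cnorm2_RtoC; unfold box.
  destruct (Z.leb_spec N (x + 1)), (Z.leb_spec N x), (Z.ltb_spec (x + 1) (N + Z.of_nat m)),
    (Z.ltb_spec x (N + Z.of_nat m)), (Z.eqb_spec x (N - 1)),
    (Z.eqb_spec x (N + Z.of_nat m - 1)); simpl; try lia; nra.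
- rewrite wsum_lin, !wsum_point.
  destruct (Z.leb (Z.abs (N - 1)) (Z.of_nat n)),
    (Z.leb (Z.abs (N + Z.of_nat m - 1)) (Z.of_nat n)); nra.
Qed.

(* A truncated plane wave of a frequency at which the limiting symbol vanishes: only the two
   ends of the box contribute to its image under the limiting operator. *)
Lemma approximate_kernel A V B a v b z :
  lim_right_C A a -> lim_right_C V v -> lim_right_C B b ->
  Cnorm2 z = 1 -> (a * z + v + b * Cconj z)%Cx = C0 ->
  forall N0 e, 0 < e -> exists (f : seqZ) (M : Z),
    (forall x, (x < N0)%Z \/ (M < x)%Z -> f x = C0) /\
    l2_le (band A V B f) e /\ ~ l2_le f (1 / 2).
Proof.
intros HA HV HB Hz Hsym N0 e He.
assert (Hd : 0 < e / 6) by lra.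
destruct (HA _ Hd) as [N1 H1], (HV _ Hd) as [N2 H2], (HB _ Hd) as [N3 H3].
(* A box starting at [1] or later keeps the exponents nonnegative, so [Z.to_nat] does not truncate
   on it. *)
set (N := Z.max (Z.max 1 N0) (Z.max (N1 + 1) (Z.max N2 N3))).
pose proof (Cabs_nonneg a) as Pa; pose proof (Cabs_nonneg b) as Pb.
(* The box edges cost [2 (|a| + |b|) s], below [e / 2] once [s <= t]; the deviation of the
   coefficients from their limits costs the other half, [3 (e / 6)]. *)
set (t := e / (4 * (Cabs a + Cabs b + 1))).
assert (Ht : 0 < t) by (apply Rdiv_lt_0_compat; lra).
destruct (archimed_cor1 (t * t)) as [m [Hm1 Hm2]]; [nra |].
assert (Hm : 0 < INR m) by (apply lt_INR in Hm2; simpl in Hm2; lra).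
(* This height gives a box of [m] sites norm one. *)
set (s := sqrt (/ INR m)).
assert (Hs : 0 <= s) by apply sqrt_pos.
assert (Hss : s * s = / INR m) by (apply sqrt_sqrt, Rlt_le, Rinv_0_lt_compat; easy).
assert (Hst : s <= t) by nra.
set (chi := box N m s); set (u := fun x => Cpow z (Z.to_nat x)).
set (f := fun x => (RtoC (chi x) * u x)%Cx).
assert (Hu : forall x, Cnorm2 (u x) = 1) by (intro; apply Cnorm2_pow; easy).
assert (Hf : forall x, Cnorm2 (f x) = box N m (s * s) x).
{ intro x; unfold f; rewrite Cnorm2_mul, Hu, Cnorm2_RtoC, <- box_sqr; unfold chi; ring. }
assert (Hbox : forall n, (Z.abs N + Z.of_nat m <= Z.of_nat n)%Z ->
  wsum (fun x => Cnorm2 (f x)) n = 1).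
{ intros n Hn; rewrite (wsum_ext _ (box N m (s * s))) by (intros; apply Hf).
  rewrite wsum_box, Hss by easy; field; lra. }
assert (Hsupp : supp_in (fun x => (N <= x)%Z) f).
{ intros x hx; unfold f, chi; rewrite box_out by lia; cx_eq; ring. }
assert (Hf1 : l2_le f 1).
{ split; [lra |]; intro n.
  set (n' := max n (Z.to_nat (Z.abs N + Z.of_nat m))).
  apply Rle_trans with (wsum (fun x => Cnorm2 (f x)) n').
  - apply wsum_mono; [intro; apply Cnorm2_nonneg | lia].
  - rewrite Hbox by lia; lra. }
assert (Hzz : (z * Cconj z)%Cx = Cone).
{ destruct z as [x y]; cx_unfold; f_equal; lra. }
assert (Hfs : forall x, f (x + 1)%Z = (RtoC (chi (x + 1)%Z) * (z * u x))%Cx).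
{ intro x; unfold f; destruct (Z_lt_dec x 0) as [h | h].
  - unfold chi; rewrite box_out by lia; cx_eq; ring.
  - unfold u; replace (Z.to_nat (x + 1)) with (S (Z.to_nat x)) by lia; reflexivity. }
assert (Hfp : forall x, f (x - 1)%Z = (RtoC (chi (x - 1)%Z) * (Cconj z * u x))%Cx).
{ intro x; unfold f; destruct (Z_lt_dec x 1) as [h | h].
  - unfold chi; rewrite box_out by lia; cx_eq; ring.
  - unfold u; replace (Z.to_nat x) with (S (Z.to_nat (x - 1))) by lia; simpl.
    transitivity (RtoC (chi (x - 1)%Z) * ((z * Cconj z) * Cpow z (Z.to_nat (x - 1))))%Cx;
      [rewrite Hzz |]; ring. }
assert (Hconst : l2_le (const_band a v b f) (Cabs a * (2 * s) + Cabs b * (2 * s))).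
{ set (D := fun x => RtoC (chi (x + 1)%Z - chi x)).
  assert (HD : l2_le D (2 * s)) by (apply l2_le_box_diff; easy).
  apply l2_le_ext with (fun x => (a * z * u x) * D x - (b * Cconj z * u x) * D (x - 1)%Z)%Cx.
  - intro x; unfold const_band, band; rewrite Hfs, Hfp; unfold f, D.
    replace (x - 1 + 1)%Z with x by lia.
    assert (Hv : v = (- (a * z + b * Cconj z))%Cx).
    { transitivity ((a * z + v + b * Cconj z) - (a * z + b * Cconj z))%Cx; [| rewrite Hsym]; ring. }
    rewrite Hv.
    assert (HR : forall r r', RtoC (r - r') = (RtoC r - RtoC r')%Cx)
      by (intros; cx_eq; ring).
    rewrite !HR; ring.
  - apply l2_le_sub.
    + apply l2_le_dom with (3 := HD); [easy |]; intro x.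
      rewrite !Cnorm2_mul, Hu, Hz, Cabs_sqr; lra.
    + apply l2_le_dom with (3 := l2_le_pred _ _ HD); [easy |]; intro x.
      rewrite !Cnorm2_mul, Hu, Cnorm2_conj, Hz, Cabs_sqr; lra. }
exists f, (N + Z.of_nat m)%Z; split; [| split].
- intros x hx; unfold f, chi; rewrite box_out by lia; cx_eq; ring.
- assert (Hsq : forall w, Cabs w < e / 6 -> Cnorm2 w <= e / 6 * (e / 6)).
  { intros w Hw; rewrite <- Cabs_sqr; pose proof (Cabs_nonneg w); nra. }
  assert (Hp : l2_le (band (fun x => A x - a) (fun x => V x - v) (fun x => B x - b) f)%Cx
    (3 * (e / 6) * 1)).
  { apply l2_le_band with (fun x => (N <= x)%Z); try easy; [lra | | |];
      intros x hx; apply Hsq; [apply H1 | apply H2 | apply H3]; lia. }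
  apply l2_le_weaken with (Cabs a * (2 * s) + Cabs b * (2 * s) + 3 * (e / 6) * 1).
  + assert (2 * (Cabs a + Cabs b + 1) * t = e / 2) by (unfold t; field; lra).
    nra.
  + generalize (l2_le_add _ _ _ _ Hconst Hp); apply l2_le_ext; intro x.
    unfold const_band, band; ring.
- intros [_ h]; specialize (h (Z.to_nat (Z.abs N + Z.of_nat m))).
  rewrite Hbox in h by lia; lra.
Qed.

(** Each bump starts after the end of the previous one. Starting the [k]-th at [k] or later leaves
    only finitely many bumps to the left of any site, so series of bumps make sense pointwise. *)
Lemma disjoint_bumps (Q : seqZ -> R -> Prop) :
  (forall N0 e, 0 < e -> exists (f : seqZ) (M : Z),
    (forall x, (x < N0)%Z \/ (M < x)%Z -> f x = C0) /\ Q f e) ->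
  exists F : nat -> seqZ,
    (forall k, Q (F k) ((/ 2) ^ k)) /\
    (forall k x, (x < Z.of_nat k)%Z -> F k x = C0) /\
    (forall j k x, j <> k -> F j x <> C0 -> F k x = C0).
Proof.
intro H.
(* A bump is chosen for every start and index at once, after which the starting points [st] follow
   by plain recursion. *)
assert (Hch : forall a : Z * nat, exists r : seqZ * Z,
  (forall x, (x < fst a)%Z \/ (snd r < x)%Z -> fst r x = C0) /\ Q (fst r) ((/ 2) ^ snd a)).
{ intros [N0 k]; destruct (H N0 ((/ 2) ^ k)) as [f [M HM]]; [apply pow_lt; lra |].
  now exists (f, M). }
apply functional_choice in Hch; destruct Hch as [g Hg].
set (st := fix st k := match k with
  | O => 0%Z | S k' => Z.max (st k' + 1) (snd (g (st k', k')) + 1) end).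
assert (Hst1 : forall k, (Z.of_nat k <= st k)%Z).
{ induction k as [| k IH]; cbn [st]; lia. }
assert (Hst2 : forall j k, (j < k)%nat -> (snd (g (st j, j)) < st k)%Z).
{ intros j k; induction 1 as [| k _ IH]; cbn [st]; lia. }
exists (fun k => fst (g (st k, k))); split; [| split].
- intro k; apply Hg.
- intros k x hx; apply Hg; left; specialize (Hst1 k); simpl; lia.
- assert (Hw : forall j k x, (j < k)%nat ->
    fst (g (st j, j)) x = C0 \/ fst (g (st k, k)) x = C0).
  { intros j k x hjk; specialize (Hst2 j k hjk).
    destruct (Z_lt_dec x (st k)) as [h | h].
    - right; apply Hg; now left.
    - left; apply Hg; right; lia. }
  intros j k x hjk hx.
  destruct (Nat.lt_ge_cases j k) as [h | h].
  + destruct (Hw j k x h); easy.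
  + destruct (Hw k j x ltac:(lia)); easy.
Qed.

(** * Formal series of bumps and failure of closed range *)

Fixpoint partial_series (c : nat -> Cx) (F : nat -> seqZ) (n : nat) (x : Z) : Cx :=
  match n with
  | O => C0
  | S m => (partial_series c F m x + c m * F m x)%Cx
  end.

(* The pointwise sum of the series when [F k] vanishes to the left of [k]. *)
Definition formal_series (c : nat -> Cx) (F : nat -> seqZ) (x : Z) : Cx :=
  partial_series c F (S (Z.to_nat x)) x.

Lemma formal_series_partial c F x n :
  (forall k x, (x < Z.of_nat k)%Z -> F k x = C0) -> (x < Z.of_nat n)%Z -> (0 < n)%nat ->
  formal_series c F x = partial_series c F n x.
Proof.
intros HF Hx Hn; unfold formal_series.
assert (Hle : (S (Z.to_nat x) <= n)%nat) by lia; clear Hx Hn.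
induction Hle as [| n Hle IH]; [easy |].
change (partial_series c F (S n) x) with (partial_series c F n x + c n * F n x)%Cx.
rewrite IH, (HF n x) by lia; ring.
Qed.

Lemma formal_series_disjoint c F k x :
  (forall k x, (x < Z.of_nat k)%Z -> F k x = C0) ->
  (forall j k x, j <> k -> F j x <> C0 -> F k x = C0) ->
  F k x <> C0 -> formal_series c F x = (c k * F k x)%Cx.
Proof.
intros HF Hdis Hk.
assert (Hn : forall n, partial_series c F n x = if (k <? n)%nat then (c k * F k x)%Cx else C0).
{ induction n as [| n IH]; [reflexivity | simpl; rewrite IH].
  destruct (Nat.eq_dec k n) as [-> | h].
  - destruct (Nat.ltb_spec n n), (Nat.ltb_spec n (S n)); try lia; ring.
  - rewrite (Hdis k n x h Hk).
    destruct (Nat.ltb_spec k n), (Nat.ltb_spec k (S n)); try lia; ring. }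
unfold formal_series; rewrite Hn; destruct (Nat.ltb_spec k (S (Z.to_nat x))); [easy |].
elim Hk; apply HF; lia.
Qed.

Lemma partial_series_in_l2 c F n : (forall k, in_l2 (F k)) -> in_l2 (partial_series c F n).
Proof.
intro HF; induction n as [| n IH].
- apply l2_le_in_l2 with 0; apply l2_le_zero; [lra | easy].
- exact (in_l2_add _ _ IH (in_l2_scal (c n) _ (HF n))).
Qed.

(** The formal series itself may lie outside l2. On each window its image is that of a long partial
    sum, and the images of the remaining terms are bounded by a geometric series. *)
Lemma formal_series_approx A V B c F n0 :
  (forall k, Cnorm2 (c k) <= 1) ->
  (forall k x, (x < Z.of_nat k)%Z -> F k x = C0) ->
  (forall k, l2_le (band A V B (F k)) ((/ 2) ^ k)) ->
  l2_le (fun x => band A V B (formal_series c F) x - band A V B (partial_series c F n0) x)%Cx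
    (2 * (/ 2) ^ n0).
Proof.
intros Hc HF HT.
assert (Hfin : forall j, l2_le (fun x => band A V B (partial_series c F (n0 + j)) x
   - band A V B (partial_series c F n0) x)%Cx (2 * (/ 2) ^ n0 - 2 * (/ 2) ^ (n0 + j))).
{ induction j as [| j IH].
  - rewrite Nat.add_0_r, Rminus_diag; apply l2_le_zero; [lra |]; intro; ring.
  - rewrite Nat.add_succ_r.
    assert (Hj : l2_le (band A V B (fun x => c (n0 + j)%nat * F (n0 + j)%nat x)%Cx)
      ((/ 2) ^ (n0 + j))).
    { generalize (HT (n0 + j)%nat); apply l2_le_sub_dom; intro x.
      rewrite band_scal, Cnorm2_mul; pose proof (Hc (n0 + j)%nat).
      pose proof (Cnorm2_nonneg (band A V B (F (n0 + j)%nat) x)); nra. }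
    generalize (l2_le_add _ _ _ _ IH Hj).
    replace (2 * (/ 2) ^ n0 - 2 * (/ 2) ^ (n0 + j) + (/ 2) ^ (n0 + j))
      with (2 * (/ 2) ^ n0 - 2 * (/ 2) ^ S (n0 + j)) by (simpl; field).
    apply l2_le_ext; intro x; cbn [partial_series].
    rewrite (band_add A V B (partial_series c F (n0 + j))
      (fun x => c (n0 + j)%nat * F (n0 + j)%nat x)%Cx); ring. }
assert (Hp : forall n, 0 < (/ 2) ^ n) by (intro; apply pow_lt; lra).
split; [specialize (Hp n0); lra |]; intro n.
(* The window of radius [n] reads values up to [n + 1], where the partial sum of length
   [n0 + (n + 2)] already agrees with the series. *)
rewrite (wsum_ext _ (fun x => Cnorm2 (band A V B (partial_series c F (n0 + (n + 2))) x
   - band A V B (partial_series c F n0) x)%Cx)).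
- specialize (Hfin (n + 2)%nat); apply l2_le_weaken with (m' := 2 * (/ 2) ^ n0) in Hfin.
  + apply Hfin.
  + specialize (Hp (n0 + (n + 2))%nat); lra.
- intros x hx; do 2 f_equal; unfold band.
  now rewrite !(formal_series_partial c F _ (n0 + (n + 2))) by (easy || lia).
Qed.

(** If the first two vectors are independent, the three 2-by-2 minors are the coefficients;
    otherwise those two are already dependent. *)
Lemma three_vectors_dependent (u0 u1 u2 v0 v1 v2 : Cx) :
  exists l0 l1 l2, (l0 <> C0 \/ l1 <> C0 \/ l2 <> C0) /\
    (l0 * u0 + l1 * u1 + l2 * u2)%Cx = C0 /\ (l0 * v0 + l1 * v1 + l2 * v2)%Cx = C0.
Proof.
set (d := (u0 * v1 - u1 * v0)%Cx).
destruct (classic (d = C0)) as [Hd | Hd].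
- assert (Hv : (u1 * v0 + - u0 * v1 + C0 * v2)%Cx = C0).
  { transitivity (- d)%Cx; [unfold d; ring | rewrite Hd; ring]. }
  destruct (classic (u1 = C0)) as [H1 | H1].
  + destruct (classic (u0 = C0)) as [H0 | H0].
    * destruct (classic (v0 = C0)) as [H2 | H2].
      -- exists Cone, C0, C0; split; [left | split].
         ++ intro h; apply (f_equal fst) in h; simpl in h; lra.
         ++ rewrite H0; ring.
         ++ rewrite H2; ring.
      -- exists v1, (- v0)%Cx, C0; split; [right; left | split].
         ++ intro h; apply H2; transitivity (- - v0)%Cx; [ring | rewrite h; ring].
         ++ rewrite H0, H1; ring.
         ++ ring.
    * exists u1, (- u0)%Cx, C0; split; [right; left | split]; [| ring | easy].
      intro h; apply H0; transitivity (- - u0)%Cx; [ring | rewrite h; ring].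
  + exists u1, (- u0)%Cx, C0; split; [now left | split]; [ring | easy].
- exists (u1 * v2 - u2 * v1)%Cx, (u2 * v0 - u0 * v2)%Cx, d.
  split; [now right; right | split]; unfold d; ring.
Qed.

(** Where [A x] is nonzero the recurrence determines [f (x + 1)] from the two preceding values, so
    two zeros propagate to the right. *)
Lemma band_kernel_tail A V B N f :
  (forall x, (N <= x)%Z -> A x <> C0) -> (forall x, band A V B f x = C0) ->
  f N = C0 -> f (N - 1)%Z = C0 -> forall x, (N <= x)%Z -> f x = C0.
Proof.
intros HA Hf H0 H1.
assert (H : forall n : nat, f (N + Z.of_nat n)%Z = C0 /\ f (N + Z.of_nat n - 1)%Z = C0).
{ induction n as [| n [IH1 IH2]].
  - now rewrite Z.add_0_r.
  - replace (N + Z.of_nat (S n))%Z with (N + Z.of_nat n + 1)%Z by lia.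
    split; [| now replace (N + Z.of_nat n + 1 - 1)%Z with (N + Z.of_nat n)%Z by lia].
    specialize (Hf (N + Z.of_nat n)%Z); unfold band in Hf; rewrite IH1, IH2 in Hf.
    destruct (Cmul_integral (A (N + Z.of_nat n)%Z) (f (N + Z.of_nat n + 1)%Z)) as [h | h];
      [| exfalso; apply (HA (N + Z.of_nat n)%Z); [lia | easy] | easy].
    rewrite <- Hf; ring. }
intros x hx; replace x with (N + Z.of_nat (Z.to_nat (x - N)))%Z by lia; apply H.
Qed.

(** The periodic pattern gives each of the three coefficients infinitely many bumps, so a nonzero
    one recurs arbitrarily far out. *)
Definition mod3 (l0 l1 l2 : Cx) (k : nat) : Cx :=
  match (k mod 3)%nat with O => l0 | 1%nat => l1 | _ => l2 end.

Lemma partial_series_mod3 l0 l1 l2 F n x :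
  partial_series (mod3 l0 l1 l2) F n x =
  (l0 * partial_series (mod3 Cone C0 C0) F n x + l1 * partial_series (mod3 C0 Cone C0) F n x
   + l2 * partial_series (mod3 C0 C0 Cone) F n x)%Cx.
Proof.
induction n as [| n IH]; cbn [partial_series]; [ring |].
rewrite IH; unfold mod3; destruct (n mod 3)%nat as [| [|]]; ring.
Qed.

(* Were the range closed, each image of a formal series with bounded coefficients would be
   the image of some l2 sequence.  The difference then solves a second order recurrence on a
   right half line, and three such solutions are linearly dependent there; but a nontrivial
   combination of the three series below is not l2 at infinity. *)
Lemma not_closed_range_right A V B k a v b z :
  coef_bound A V B k ->
  lim_right_C A a -> lim_right_C V v -> lim_right_C B b ->
  a <> C0 -> Cnorm2 z = 1 -> (a * z + v + b * Cconj z)%Cx = C0 ->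
  ~ closed_range (band A V B).
Proof.
intros Hk HA HV HB Ha Hz Hsym Hcl.
assert (exists N : Z, forall x, (N <= x)%Z -> A x <> C0) as [N HN].
{ destruct (HA (Cabs a)) as [N HN]; [now apply Cabs_pos |].
  exists N; intros x hx h; specialize (HN x hx); rewrite h in HN.
  revert HN; unfold Cabs; replace (Cnorm2 (C0 - a)%Cx) with (Cnorm2 a) by (cx_unfold; ring).
  lra. }
destruct (disjoint_bumps (fun f e => in_l2 f /\ l2_le (band A V B f) e /\ ~ l2_le f (1 / 2)))
  as [F [HF [HF0 Hdis]]].
{ intros N0 e He.
  destruct (approximate_kernel A V B a v b z HA HV HB Hz Hsym N0 e He) as [f [M [H1 [H2 H3]]]].
  exists f, M; split; [easy | split; [| easy]].
  exists (wsum (fun x => Cnorm2 (f x)) (Z.to_nat (Z.max (Z.abs N0) (Z.abs M)))); intro n.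
  rewrite partial_norm2_wsum.
  destruct (Nat.le_ge_cases n (Z.to_nat (Z.max (Z.abs N0) (Z.abs M)))) as [h | h].
  - apply wsum_mono; [intro; apply Cnorm2_nonneg | easy].
  - induction h as [| n h IH]; [lra | cbn [wsum]].
    rewrite (H1 (Z.of_nat (S n))), (H1 (- Z.of_nat (S n))%Z), Cnorm2_C0 by lia; lra. }
assert (HFin : forall n, in_l2 (F n)) by (intro; apply HF).
assert (HFT : forall n, l2_le (band A V B (F n)) ((/ 2) ^ n)) by (intro; apply HF).
assert (Hsol : forall c, (forall n, Cnorm2 (c n) <= 1) ->
  exists g, in_l2 g /\ forall x, band A V B g x = band A V B (formal_series c F) x).
{ intros c Hc; destruct (Hcl (band A V B (formal_series c F))) as [g [Hg1 Hg2]].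
  (* The empty partial sum is zero, so the estimate bounds the image of the series itself. *)
  - pose proof (formal_series_approx A V B c F 0 Hc HF0 HFT) as h.
    apply l2_le_in_l2 in h; revert h; apply in_l2_restrict; intro x; left.
    unfold band; simpl; ring.
  - intros e He.
    destruct (pow_lt_1_zero (/ 2) ltac:(rewrite Rabs_pos_eq; lra) (e / 2) ltac:(lra))
      as [n Hn].
    specialize (Hn n (le_n _)); rewrite Rabs_pos_eq in Hn by (apply pow_le; lra).
    exists (partial_series c F n); split; [now apply partial_series_in_l2 |].
    apply l2_norm_lt_iff; [easy |]; exists (2 * (/ 2) ^ n); split; [lra |].
    generalize (formal_series_approx A V B c F n Hc HF0 HFT); apply l2_le_sub_dom.
    intro x; right; unfold seq_sub; cx_unfold; ring.
  - exists g; split; [easy |]; intro x; now rewrite Hg2. }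
assert (Hm3 : forall i j l : Cx, Cnorm2 i <= 1 -> Cnorm2 j <= 1 -> Cnorm2 l <= 1 ->
  forall n, Cnorm2 (mod3 i j l n) <= 1).
{ intros i j l Hi Hj Hl n; unfold mod3; destruct (n mod 3)%nat as [| [|]]; easy. }
assert (P0 : Cnorm2 C0 <= 1) by (rewrite Cnorm2_C0; lra).
assert (P1 : Cnorm2 Cone <= 1) by (rewrite Cnorm2_Cone; lra).
destruct (Hsol _ (Hm3 Cone C0 C0 P1 P0 P0)) as [g0 [Hg0 Eg0]].
destruct (Hsol _ (Hm3 C0 Cone C0 P0 P1 P0)) as [g1 [Hg1 Eg1]].
destruct (Hsol _ (Hm3 C0 C0 Cone P0 P0 P1)) as [g2 [Hg2 Eg2]].
set (s0 := formal_series (mod3 Cone C0 C0) F) in *.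
set (s1 := formal_series (mod3 C0 Cone C0) F) in *.
set (s2 := formal_series (mod3 C0 C0 Cone) F) in *.
(* Each series minus its l2 solution lies in the kernel. A combination vanishing at [N] and [N - 1]
   vanishes from [N] on, so there the combined series equals the l2 sequence [g]. *)
destruct (three_vectors_dependent (s0 N - g0 N)%Cx (s1 N - g1 N)%Cx (s2 N - g2 N)%Cx
  (s0 (N - 1)%Z - g0 (N - 1)%Z)%Cx (s1 (N - 1)%Z - g1 (N - 1)%Z)%Cx
  (s2 (N - 1)%Z - g2 (N - 1)%Z)%Cx) as [l0 [l1 [l2 [Hl [E0 E1]]]]].
set (g := fun x => (l0 * g0 x + l1 * g1 x + l2 * g2 x)%Cx).
assert (Hg : in_l2 g).
{ apply (in_l2_add (fun x => l0 * g0 x + l1 * g1 x)%Cx); [apply in_l2_add |];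
    now apply in_l2_scal. }
set (s := formal_series (mod3 l0 l1 l2) F).
assert (HS : forall x, s x = (l0 * s0 x + l1 * s1 x + l2 * s2 x)%Cx)
  by (intro; apply partial_series_mod3).
assert (Heq : forall x, (N <= x)%Z -> s x = g x).
{ intros x hx.
  assert (h : (s x - g x)%Cx = C0).
  { apply (band_kernel_tail A V B N (fun x => s x - g x)%Cx); try easy.
    - intro t; transitivity (l0 * (band A V B s0 t - band A V B g0 t)
        + l1 * (band A V B s1 t - band A V B g1 t)
        + l2 * (band A V B s2 t - band A V B g2 t))%Cx.
      + unfold band, g; rewrite !HS; ring.
      + rewrite Eg0, Eg1, Eg2; ring.
    - unfold g; rewrite HS, <- E0; ring.
    - unfold g; rewrite HS, <- E1; ring. }
  transitivity (s x - g x + g x)%Cx; [ring | rewrite h; ring]. }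
assert (exists j l, (j < 3)%nat /\ l <> C0 /\
  forall i, mod3 l0 l1 l2 (j + i * 3) = l) as [j [l [Hj [Hl0 Hjl]]]].
{ unfold mod3; destruct Hl as [h | [h | h]];
    [exists 0%nat, l0 | exists 1%nat, l1 | exists 2%nat, l2]; split; try lia;
    (split; [easy |]); intro i; rewrite Nat.Div0.mod_add; reflexivity. }
pose proof (Cabs_pos l Hl0) as Hlp; pose proof (Cnorm2_pos l Hl0).
destruct (l2_tail g (Cabs l / 2)) as [N1 HN1]; [easy | lra |].
(* Bump [j + 3 i] lies beyond both [N] and [N1]. There [g] is [l] times the bump, so the tail bound
   [|l| / 2] would give the bump norm at most [1 / 2]. *)
set (i := Z.to_nat (Z.max (Z.abs N) (Z.abs N1))).
destruct (HF (j + i * 3)%nat) as [_ [_ Hbig]]; apply Hbig.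
set (n := (j + i * 3)%nat) in *.
assert (Hn : (N <= Z.of_nat n)%Z /\ (N1 <= Z.of_nat n)%Z) by lia.
replace (1 / 2) with (/ Cabs l * (Cabs l / 2)) by (field; lra).
apply l2_le_dom with (fun x => l * F n x)%Cx.
- apply Rlt_le, Rinv_0_lt_compat; easy.
- intro x; right; rewrite Cnorm2_mul, <- Rinv_mult, Cabs_sqr; field; lra.
- apply HN1.
  + intros x hx; rewrite HF0 by lia; ring.
  + intro x; destruct (classic (F n x = C0)) as [h | h]; [right; rewrite h; ring | left].
    rewrite <- Heq.
    * unfold s; rewrite (formal_series_disjoint _ F n x HF0 Hdis h).
      unfold n at 2; now rewrite Hjl.
    * destruct (Z_le_dec N x) as [| h']; [easy | elim h; apply HF0; lia].
Qed.

(** The reflection of the line is an isometry that exchanges the two off-diagonals, so results at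
    the right end carry over to the left. *)
Lemma closed_range_reflect A V B :
  closed_range (band A V B) ->
  closed_range (band (fun x => B (- x)%Z) (fun x => V (- x)%Z) (fun x => A (- x)%Z)).
Proof.
set (T' := band (fun x => B (- x)%Z) (fun x => V (- x)%Z) (fun x => A (- x)%Z)).
assert (HT : forall f x, band A V B (fun t => f (- t)%Z) x = T' f (- x)%Z).
{ intros f x; unfold T', band; rewrite !Z.opp_involutive.
  replace (- (x + 1))%Z with (- x - 1)%Z by lia.
  replace (- (x - 1))%Z with (- x + 1)%Z by lia; ring. }
assert (Hin : forall f, in_l2 f -> in_l2 (fun x => f (- x)%Z)).
{ intros f Hf; destruct (in_l2_l2_le f Hf) as [m Hm].
  exact (l2_le_in_l2 _ _ (l2_le_neg _ _ Hm)). }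
intros H y Hy Hap.
destruct (H (fun x => y (- x)%Z)) as [f [Hf1 Hf2]].
- now apply Hin.
- intros e He; destruct (Hap e He) as [f [Hf1 Hf2]].
  exists (fun x => f (- x)%Z); split; [now apply Hin |].
  apply l2_norm_lt_iff in Hf2; [| easy]; destruct Hf2 as [m [Hm Hf2]].
  apply l2_norm_lt_iff; [easy |]; exists m; split; [easy |].
  generalize (l2_le_neg _ _ Hf2); apply l2_le_ext; intro x.
  unfold seq_sub; now rewrite HT.
- exists (fun x => f (- x)%Z); split; [now apply Hin |].
  apply functional_extensionality; intro x.
  rewrite <- (Z.opp_involutive x) at 1; rewrite <- HT.
  transitivity (band A V B f (- x)%Z).
  + unfold band; now rewrite !Z.opp_involutive.
  + now rewrite Hf2, Z.opp_involutive.
Qed.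

Lemma lim_right_reflect f l : lim_left_C f l -> lim_right_C (fun x => f (- x)%Z) l.
Proof.
intros H e He; destruct (H e He) as [N HN]; exists (- N)%Z; intros x hx; apply HN; lia.
Qed.

(** Under reflection [a] and [b] change places and [z] becomes its conjugate, which is why [b] must
    be nonzero here. *)
Lemma not_closed_range_left A V B k a v b z :
  coef_bound A V B k ->
  lim_left_C A a -> lim_left_C V v -> lim_left_C B b ->
  b <> C0 -> Cnorm2 z = 1 -> (a * z + v + b * Cconj z)%Cx = C0 ->
  ~ closed_range (band A V B).
Proof.
intros [Hk0 Hk] HA HV HB Hb Hz Hsym H.
apply closed_range_reflect in H; revert H.
apply not_closed_range_right with k b v a (Cconj z); auto using lim_right_reflect.
- split; [easy |]; intro x; destruct (Hk (- x)%Z) as [? [? ?]]; auto.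
- now rewrite Cnorm2_conj.
- rewrite <- Hsym; replace (Cconj (Cconj z)) with z; [ring |].
  destruct z; cx_eq; ring.
Qed.

(** * The two ends of the line *)

(* [D N x] reads "x is beyond N"; the two instances used are [N <= x] and [x <= N]. *)
Definition direction (D : Z -> Z -> Prop) : Prop :=
  (forall N M, exists K, forall x, D K x -> D N x /\ D M x) /\
  (forall N, exists K, forall x, D K x -> D N (x + 1)%Z) /\
  (forall N, exists x, D N x).

Definition to_right (N x : Z) : Prop := (N <= x)%Z.
Definition to_left (N x : Z) : Prop := (x <= N)%Z.

Lemma direction_right : direction to_right.
Proof.
unfold to_right; split; [| split].
- intros N M; exists (Z.max N M); intros; lia.
- intro N; exists N; intros; lia.
- intro N; exists N; lia.
Qed.

Lemma direction_left : direction to_left.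
Proof.
unfold to_left; split; [| split].
- intros N M; exists (Z.min N M); intros; lia.
- intro N; exists (N - 1)%Z; intros; lia.
- intro N; exists N; lia.
Qed.

Definition lim_R (D : Z -> Z -> Prop) (f : Z -> R) (l : R) : Prop :=
  forall eps, 0 < eps -> exists N : Z, forall x : Z, D N x -> Rabs (f x - l) < eps.
Definition lim_C (D : Z -> Z -> Prop) (f : Z -> Cx) (l : Cx) : Prop :=
  forall eps, 0 < eps -> exists N : Z, forall x : Z, D N x -> Cabs (Csub (f x) l) < eps.

Lemma lim_C_scal D c f l : lim_C D f l -> lim_C D (fun x => c * f x)%Cx (c * l)%Cx.
Proof.
intros H e He; pose proof (Cabs_nonneg c).
destruct (H (e / (Cabs c + 1))) as [N HN]; [apply Rdiv_lt_0_compat; lra |].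
exists N; intros x hx; specialize (HN x hx).
replace (c * f x - c * l)%Cx with (c * (f x - l))%Cx by ring; rewrite Cabs_mul.
apply Rlt_le_trans with ((Cabs c + 1) * (e / (Cabs c + 1))); [| right; field; lra].
pose proof (Cabs_nonneg (f x - l)%Cx); nra.
Qed.

Lemma lim_C_conj D f l : lim_C D f l -> lim_C D (fun x => Cconj (f x)) (Cconj l).
Proof.
intros H e He; destruct (H e He) as [N HN]; exists N; intros x hx; specialize (HN x hx).
replace (Cconj (f x) - Cconj l)%Cx with (Cconj (f x - l)%Cx) by (cx_eq; ring).
unfold Cabs in *; now rewrite Cnorm2_conj.
Qed.

Lemma lim_C_shift D f l : direction D -> lim_C D f l -> lim_C D (fun x => f (x + 1)%Z) l.
Proof.
intros [_ [HD _]] H e He; destruct (H e He) as [N HN], (HD N) as [K HK]; exists K; auto.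
Qed.

Lemma lim_C_RtoC_sub D f g l m :
  direction D -> lim_R D f l -> lim_R D g m ->
  lim_C D (fun x => RtoC (f (x + 1)%Z - g x)) (RtoC (l - m)).
Proof.
intros [HD1 [HD2 _]] Hf Hg e He.
destruct (Hf (e / 2)) as [N HN]; [lra |]; destruct (Hg (e / 2)) as [M HM]; [lra |].
destruct (HD2 N) as [N' HN'], (HD1 N' M) as [K HK]; exists K; intros x hx.
destruct (HK x hx) as [h1 h2]; specialize (HN _ (HN' x h1)); specialize (HM x h2).
replace (Cabs _) with (Rabs ((f (x + 1)%Z - g x) - (l - m))).
- apply Rabs_def2 in HN; apply Rabs_def2 in HM; apply Rabs_def1; lra.
- unfold Cabs; rewrite <- sqrt_Rsqr_abs; unfold Rsqr; f_equal; cx_unfold; ring.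
Qed.

(** One sequence of sites realizes all limits together, so identities between coefficients pass to
    the limit by the algebra of [Un_cv]. *)
Lemma lim_sample D a1 a2 b l1 l2 lb :
  direction D -> lim_R D a1 l1 -> lim_R D a2 l2 -> lim_C D b lb ->
  exists x : nat -> Z, Un_cv (fun n => a1 (x n)) l1 /\ Un_cv (fun n => a2 (x n)) l2 /\
    Un_cv (fun n => fst (b (x n))) (fst lb) /\ Un_cv (fun n => snd (b (x n))) (snd lb).
Proof.
intros [HD1 [_ HD3]] H1 H2 Hb.
assert (Hch : forall n : nat, exists x, Rabs (a1 x - l1) < / (INR n + 1) /\
  Rabs (a2 x - l2) < / (INR n + 1) /\ Rabs (fst (b x) - fst lb) < / (INR n + 1) /\
  Rabs (snd (b x) - snd lb) < / (INR n + 1)).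
{ intro n; assert (He : 0 < / (INR n + 1))
    by (apply Rinv_0_lt_compat; pose proof (pos_INR n); lra).
  destruct (H1 _ He) as [N1 h1], (H2 _ He) as [N2 h2], (Hb _ He) as [N3 h3].
  destruct (HD1 N1 N2) as [K HK], (HD1 K N3) as [K' HK'], (HD3 K') as [x hx].
  destruct (HK' x hx) as [hx1 hx2]; destruct (HK x hx1) as [hx3 hx4].
  exists x; split; [auto | split; [auto |]].
  specialize (h3 x hx2); revert h3; unfold Cabs; intro h3.
  split; (apply Rle_lt_trans with (2 := h3); rewrite <- sqrt_Rsqr_abs;
    apply sqrt_le_1_alt; unfold Rsqr; cx_unfold).
  - pose proof (Rle_0_sqr (snd (b x) - snd lb)); unfold Rsqr in *; lra.
  - pose proof (Rle_0_sqr (fst (b x) - fst lb)); unfold Rsqr in *; lra. }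
apply functional_choice in Hch; destruct Hch as [x Hx]; exists x.
assert (Hcv : forall (u : nat -> R) l, (forall n, Rabs (u n - l) < / (INR n + 1)) -> Un_cv u l).
{ intros u l Hu e He; destruct (inv_succ_small e He) as [n0 Hn0]; exists n0; intros n Hn.
  apply Rlt_trans with (/ (INR n + 1)); [apply Hu | now apply Hn0]. }
repeat split; apply Hcv; intro n; apply Hx.
Qed.

Lemma limit_coin D a1 a2 b l1 l2 lb :
  direction D -> lim_R D a1 l1 -> lim_R D a2 l2 -> lim_C D b lb ->
  (forall x, a1 x * a1 x + Cnorm2 (b x) = 1) -> (forall x, a2 x * a2 x + Cnorm2 (b x) = 1) ->
  (forall x, Cmul (b x) (RtoC (a1 x + a2 x)) = C0) ->
  l1 * l1 + Cnorm2 lb = 1 /\ l2 * l2 + Cnorm2 lb = 1 /\ (lb <> C0 -> l2 = - l1).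
Proof.
intros HD H1 H2 Hb Ha1 Ha2 Hab.
destruct (lim_sample D a1 a2 b l1 l2 lb) as [x [L1 [L2 [L3 L4]]]]; try easy.
assert (Hc : forall (u : nat -> R) l r, Un_cv u l -> (forall n, u n = r) -> l = r).
{ intros u l r Hu Hr; apply UL_sequence with u; [easy |].
  intros e He; exists 0%nat; intros n _; unfold Rdist; rewrite Hr, Rminus_diag, Rabs_R0; easy. }
assert (Lb := CV_plus _ _ _ _ (CV_mult _ _ _ _ L3 L3) (CV_mult _ _ _ _ L4 L4)).
split; [| split].
- apply (Hc _ _ 1 (CV_plus _ _ _ _ (CV_mult _ _ _ _ L1 L1) Lb)); intro; apply Ha1.
- apply (Hc _ _ 1 (CV_plus _ _ _ _ (CV_mult _ _ _ _ L2 L2) Lb)); intro; apply Ha2.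
- intro Hlb.
  assert (Hre : fst lb * (l1 + l2) = 0).
  { apply (Hc _ _ 0 (CV_mult _ _ _ _ L3 (CV_plus _ _ _ _ L1 L2))); intro n.
    specialize (Hab (x n)); apply (f_equal fst) in Hab; cx_unfold; lra. }
  assert (Him : snd lb * (l1 + l2) = 0).
  { apply (Hc _ _ 0 (CV_mult _ _ _ _ L4 (CV_plus _ _ _ _ L1 L2))); intro n.
    specialize (Hab (x n)); apply (f_equal snd) in Hab; cx_unfold; lra. }
  destruct (Rmult_integral _ _ Hre) as [h |]; [| lra].
  destruct (Rmult_integral _ _ Him) as [h' |]; [| lra].
  elim Hlb; destruct lb; simpl in *; subst; reflexivity.
Qed.

(** * The operator of the walk *)

Definition half_i : Cx := Cscale (/ 2) Ci.
Definition up_coef (p : R) (q : Cx) : Cx := (half_i * RtoC (1 + p) * expiArg q)%Cx.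
Definition down_coef (p : R) (q : Cx) : Cx :=
  (- (half_i * RtoC (1 - p) * Cconj (expiArg q)))%Cx.
Definition diag_coef (q : Cx) : Cx := (half_i * RtoC (Cabs q))%Cx.

Definition walk_A p q (b : Z -> Cx) : Z -> Cx := fun x => (up_coef p q * b (x + 1)%Z)%Cx.
Definition walk_B p q (b : Z -> Cx) : Z -> Cx := fun x => (down_coef p q * Cconj (b x))%Cx.
Definition walk_V q (a1 a2 : Z -> R) : Z -> Cx :=
  fun x => (diag_coef q * RtoC (a2 (x + 1)%Z - a1 x))%Cx.

Lemma Qeps_band p q a1 a2 b :
  Qeps p q a1 a2 b = band (walk_A p q b) (walk_V q a1 a2) (walk_B p q b).
Proof.
apply functional_extensionality; intro f; apply functional_extensionality; intro x.
unfold Qeps, Tminus2iQ, band, walk_A, walk_B, walk_V, up_coef, down_coef, diag_coef.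
fold half_i.
assert (HS : forall r z, Cscale r z = (RtoC r * z)%Cx) by (intros; cx_eq; ring).
rewrite !HS.
replace (RtoC (Cabs q * (a2 (x + 1)%Z - a1 x)))
  with (RtoC (Cabs q) * RtoC (a2 (x + 1)%Z - a1 x))%Cx by (cx_eq; ring).
ring.
Qed.

Lemma Cnorm2_expiArg q : q <> C0 -> Cnorm2 (expiArg q) = 1.
Proof.
intro Hq; pose proof (Cabs_pos q Hq); unfold expiArg.
replace (Cnorm2 _) with (/ Cabs q * / Cabs q * Cnorm2 q) by (cx_unfold; ring).
rewrite <- Cabs_sqr; field; lra.
Qed.

Lemma Cnorm2_half_i : Cnorm2 half_i = / 4.
Proof. unfold half_i; cx_unfold; field. Qed.

(** The factors [(1 + p) / 2], [(1 - p) / 2], [|b|] and [|q|] are at most one, and [|a2 - a1| / 2]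
    is as well. *)
Lemma walk_coef_bound p q a1 a2 b :
  q <> C0 -> p * p + Cnorm2 q = 1 ->
  (forall x, a1 x * a1 x + Cnorm2 (b x) = 1) -> (forall x, a2 x * a2 x + Cnorm2 (b x) = 1) ->
  coef_bound (walk_A p q b) (walk_V q a1 a2) (walk_B p q b) 1.
Proof.
intros Hq Hpq Ha1 Ha2; split; [lra |]; intro x.
pose proof (Cnorm2_nonneg q).
assert (Hp : -1 <= p <= 1) by nra.
assert (Hb : forall x, 0 <= Cnorm2 (b x) <= 1).
{ intro t; pose proof (Ha1 t); pose proof (Cnorm2_nonneg (b t)).
  pose proof (Rle_0_sqr (a1 t)); unfold Rsqr in *; lra. }
unfold walk_A, walk_V, walk_B, up_coef, down_coef, diag_coef.
assert (Hopp : forall z, Cnorm2 (- z)%Cx = Cnorm2 z) by (intro; cx_unfold; ring).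
rewrite !Cnorm2_mul, Hopp, !Cnorm2_mul, !Cnorm2_conj, !Cnorm2_RtoC, Cnorm2_half_i,
  Cnorm2_expiArg, Cabs_sqr by easy.
split; [| split].
- specialize (Hb (x + 1)%Z); nra.
- specialize (Ha2 (x + 1)%Z); specialize (Ha1 x).
  pose proof (Hb (x + 1)%Z); pose proof (Hb x).
  pose proof (Rle_0_sqr (a2 (x + 1)%Z - a1 x)); pose proof (Rle_0_sqr (a2 (x + 1)%Z + a1 x)).
  unfold Rsqr in *.
  assert ((a2 (x + 1)%Z - a1 x) * (a2 (x + 1)%Z - a1 x) <= 4) by lra.
  assert (Cnorm2 q <= 1) by nra.
  apply Rle_trans with (/ 4 * 1 * 4); [| lra].
  apply Rmult_le_compat; lra.
- specialize (Hb x); nra.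
Qed.

(** * Limiting symbol of the walk at one end *)

Section WalkEnd.

Context (D : Z -> Z -> Prop) (p : R) (q : Cx) (a1 a2 : Z -> R) (b : Z -> Cx).
Context (l1 l2 : R) (lb : Cx).
Hypotheses (HD : direction D) (Hq : q <> C0) (Hpq : p * p + Cnorm2 q = 1).
Hypotheses (Ha1 : forall x, a1 x * a1 x + Cnorm2 (b x) = 1)
  (Ha2 : forall x, a2 x * a2 x + Cnorm2 (b x) = 1)
  (Hab : forall x, Cmul (b x) (RtoC (a1 x + a2 x)) = C0).
Hypotheses (H1 : lim_R D a1 l1) (H2 : lim_R D a2 l2) (Hb : lim_C D b lb).

Let lA : Cx := (up_coef p q * lb)%Cx.
Let lV : Cx := (diag_coef q * RtoC (l2 - l1))%Cx.
Let lB : Cx := (down_coef p q * Cconj lb)%Cx.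

Lemma walk_lim_A : lim_C D (walk_A p q b) lA.
Proof. apply (lim_C_scal D (up_coef p q) (fun x => b (x + 1)%Z)), lim_C_shift; easy. Qed.

Lemma walk_lim_V : lim_C D (walk_V q a1 a2) lV.
Proof. apply (lim_C_scal D (diag_coef q)), lim_C_RtoC_sub; easy. Qed.

Lemma walk_lim_B : lim_C D (walk_B p q b) lB.
Proof. apply (lim_C_scal D (down_coef p q) (fun x => Cconj (b x))), lim_C_conj; easy. Qed.

Lemma walk_p_bound : 0 < 1 + p /\ 0 < 1 - p.
Proof. pose proof (Cnorm2_pos q Hq); nra. Qed.

Lemma walk_limit_nonzero : lb <> C0 -> lA <> C0 /\ lB <> C0.
Proof.
intro Hlb; pose proof (Cnorm2_pos lb Hlb); destruct walk_p_bound.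
assert (Hopp : forall z, Cnorm2 (- z)%Cx = Cnorm2 z) by (intro; cx_unfold; ring).
split; intro h; apply (f_equal Cnorm2) in h; revert h; unfold lA, lB, up_coef, down_coef;
  rewrite !Cnorm2_mul, ?Hopp, ?Cnorm2_mul, ?Cnorm2_conj, Cnorm2_RtoC, Cnorm2_half_i,
    Cnorm2_expiArg, Cnorm2_C0 by easy; intro h.
- assert (0 < (1 + p) * (1 + p)) by nra; nra.
- assert (0 < (1 - p) * (1 - p)) by nra; nra.
Qed.

(* The wave number [z] for which [e^{i theta} b z = |b| w]. *)
Definition wave (w : R) : Cx := (RtoC (w / Cabs lb) * Cconj (expiArg q * lb))%Cx.

Lemma Cnorm2_wave w : lb <> C0 -> Cnorm2 (wave w) = w * w.
Proof.
intro Hlb; pose proof (Cabs_pos lb Hlb); unfold wave.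
rewrite Cnorm2_mul, Cnorm2_conj, Cnorm2_RtoC, Cnorm2_mul, Cnorm2_expiArg, <- Cabs_sqr by easy.
field; lra.
Qed.

Lemma expiArg_unit : (expiArg q * Cconj (expiArg q))%Cx = Cone.
Proof.
pose proof (Cnorm2_expiArg q Hq) as h; destruct (expiArg q); cx_unfold; f_equal; lra.
Qed.

(** All phases cancel at [wave w] except that of [half_i], which reduces questions about the symbol
    to real equations in [w]. *)
Lemma lA_wave w : lb <> C0 -> (lA * wave w)%Cx = (half_i * RtoC ((1 + p) * (w * Cabs lb)))%Cx.
Proof.
intro Hlb; pose proof (Cabs_pos lb Hlb).
transitivity (half_i * RtoC (1 + p) * RtoC (w / Cabs lb)
  * (expiArg q * Cconj (expiArg q)) * (lb * Cconj lb))%Cx.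
- unfold lA, up_coef, wave; rewrite Cconj_mul; ring.
- rewrite expiArg_unit, Cmul_conj.
  transitivity (half_i * (RtoC (1 + p) * (RtoC (w / Cabs lb) * RtoC (Cabs lb * Cabs lb))))%Cx;
    [ring |].
  rewrite <- !RtoC_mul; do 2 f_equal; field; lra.
Qed.

Lemma lB_wave w :
  lb <> C0 -> (lB * Cconj (wave w))%Cx = (half_i * RtoC (- ((1 - p) * (w * Cabs lb))))%Cx.
Proof.
intro Hlb; pose proof (Cabs_pos lb Hlb).
transitivity (- (half_i * RtoC (1 - p) * RtoC (w / Cabs lb)
  * (expiArg q * Cconj (expiArg q)) * (lb * Cconj lb)))%Cx.
- unfold lB, down_coef, wave; rewrite !Cconj_mul, !Cconj_conj, Cconj_RtoC; ring.
- rewrite expiArg_unit, Cmul_conj.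
  transitivity (half_i * (RtoC (-1) * (RtoC (1 - p)
    * (RtoC (w / Cabs lb) * RtoC (Cabs lb * Cabs lb)))))%Cx.
  + replace (RtoC (-1)) with (- Cone)%Cx by (cx_eq; ring); ring.
  + rewrite <- !RtoC_mul; do 2 f_equal; field; lra.
Qed.

(** [|p| = |l1|] forces [|lb| = |q|]. Since [l2 = - l1], the symbol at [wave w] with [w] equal to
    [1] or [-1] is [half_i] times [2 |q| (p w - l1)], which one of the two signs kills. *)
Lemma walk_symbol_zero :
  lb <> C0 -> Rabs p = Rabs l1 ->
  exists z, Cnorm2 z = 1 /\ (lA * z + lV + lB * Cconj z)%Cx = C0.
Proof.
intros Hlb Habs; pose proof (Cabs_pos lb Hlb); pose proof (Cabs_pos q Hq).
destruct (limit_coin D a1 a2 b l1 l2 lb) as [E1 [E2 E3]]; try easy.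
specialize (E3 Hlb).
assert (Hpl : p * p = l1 * l1).
{ pose proof (Rsqr_abs p); pose proof (Rsqr_abs l1); rewrite Habs in *.
  unfold Rsqr in *; lra. }
assert (Hr : Cabs lb = Cabs q) by (unfold Cabs; f_equal; lra).
assert (exists w, w * w = 1 /\ p * w = l1) as [w [Hw1 Hw2]].
{ destruct (Rmult_integral (p - l1) (p + l1)) as [h | h]; [lra | exists 1 | exists (-1)];
    split; lra. }
exists (wave w); split; [now rewrite Cnorm2_wave |].
rewrite lA_wave, lB_wave by easy; unfold lV, diag_coef.
transitivity (half_i * (RtoC ((1 + p) * (w * Cabs lb)) + RtoC (Cabs q) * RtoC (l2 - l1)
  + RtoC (- ((1 - p) * (w * Cabs lb)))))%Cx; [ring |].
rewrite <- RtoC_mul, <- !RtoC_add, E3, Hr.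
replace (_ + _) with (2 * Cabs q * (p * w - l1)) by ring.
rewrite Hw2, Rminus_diag, Rmult_0_r; cx_eq; ring.
Qed.

(* The roots of [(1+p) r w^2 - 2 |q| l1 w - (1-p) r], with [r = |lb|], have this closed form
   because the discriminant is [4 |q|^2 (l1^2 + r^2) = 4 |q|^2]. *)
Definition root (s : R) : R := Cabs q * (l1 + s) / ((1 + p) * Cabs lb).

(** With [|q|^2 = (1 - p) (1 + p)] and [|lb|^2 = (s - l1) (s + l1)], a root of modulus one satisfies
    [(1 - p) (s + l1) = (1 + p) (s - l1)] after cancellation, that is, [l1 = p s]. *)
Lemma Cabs_wave_root s :
  lb <> C0 -> s * s = 1 -> Rabs p <> Rabs l1 -> Cabs (wave (root s)) <> 1.
Proof.
intros Hlb Hs Habs h; pose proof (Cabs_pos lb Hlb); destruct walk_p_bound.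
destruct (limit_coin D a1 a2 b l1 l2 lb) as [E1 [E2 E3]]; try easy.
assert (h2 : root s * root s = 1) by (rewrite <- Cnorm2_wave, <- Cabs_sqr, h by easy; ring).
assert (h3 : Cnorm2 q * ((l1 + s) * (l1 + s)) = (1 + p) * (1 + p) * Cnorm2 lb).
{ rewrite <- (Cabs_sqr q), <- (Cabs_sqr lb).
  transitivity (root s * root s * ((1 + p) * Cabs lb * ((1 + p) * Cabs lb))).
  - unfold root; field; lra.
  - rewrite h2; ring. }
pose proof (Cnorm2_pos lb Hlb).
replace (Cnorm2 q) with ((1 - p) * (1 + p)) in h3 by lra.
replace (Cnorm2 lb) with ((s - l1) * (s + l1)) in h3 by lra.
assert (h4 : (1 + p) * (s + l1) * (2 * (l1 - p * s)) = 0) by lra.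
assert (s + l1 <> 0) by (intro h5; assert ((s - l1) * (s + l1) = Cnorm2 lb) by lra; nra).
destruct (Rmult_integral _ _ h4) as [h5 | h5].
- destruct (Rmult_integral _ _ h5); lra.
- apply Habs; replace l1 with (p * s) by lra; rewrite Rabs_mult.
  replace (Rabs s) with 1; [ring |].
  destruct (Rmult_integral (s - 1) (s + 1)) as [h6 | h6]; [lra | |].
  + replace s with 1 by lra; now rewrite Rabs_R1.
  + replace s with (-1) by lra; rewrite Rabs_left; lra.
Qed.

Lemma walk_limit_bounded_below :
  lb <> C0 -> Rabs p <> Rabs l1 ->
  exists K, bounded_below_on everywhere (const_band lA lV lB) K.
Proof.
intros Hlb Habs; pose proof (Cabs_pos lb Hlb); destruct walk_p_bound.
destruct (limit_coin D a1 a2 b l1 l2 lb) as [E1 [E2 E3]]; try easy; specialize (E3 Hlb).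
apply const_band_bounded_below with (wave (root 1)) (wave (root (-1))).
- now apply walk_limit_nonzero.
- apply Cabs_wave_root; auto; ring.
- apply Cabs_wave_root; auto; ring.
(* Vieta's formula for the sum: [s] cancels between the two roots, and [l2 = - l1] supplies the
   factor two. *)
- transitivity (- (lA * wave (root 1) + lA * wave (root (-1))))%Cx; [| ring].
  rewrite !lA_wave by easy; unfold lV, diag_coef.
  transitivity (half_i * RtoC (Cabs q * (l2 - l1)))%Cx; [rewrite RtoC_mul; ring |].
  transitivity (half_i * (RtoC (-1) * (RtoC ((1 + p) * (root 1 * Cabs lb))
    + RtoC ((1 + p) * (root (-1) * Cabs lb)))))%Cx.
  + rewrite <- RtoC_add, <- RtoC_mul; do 2 f_equal; unfold root; rewrite E3; field; lra.
  + replace (RtoC (-1)) with (- Cone)%Cx by (cx_eq; ring); ring.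
(* Vieta's formula for the product: [root 1 * root (-1) = - (1 - p) / (1 + p)]. *)
- transitivity (lA * wave (root 1) * wave (root (-1)))%Cx; [| ring].
  rewrite lA_wave by easy; unfold lB, down_coef, wave; rewrite Cconj_mul.
  transitivity (half_i * RtoC (- (1 - p)) * (Cconj (expiArg q) * Cconj lb))%Cx.
  + replace (RtoC (- (1 - p))) with (- RtoC (1 - p))%Cx by (cx_eq; ring); ring.
  + transitivity (half_i * (RtoC ((1 + p) * (root 1 * Cabs lb)) * RtoC (root (-1) / Cabs lb))
      * (Cconj (expiArg q) * Cconj lb))%Cx; [| ring].
    do 2 f_equal; rewrite <- RtoC_mul; f_equal; unfold root.
    pose proof (Cabs_sqr q); pose proof (Cabs_sqr lb).
    transitivity (- ((Cabs q * Cabs q) * (1 - l1 * l1)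
      / ((1 + p) * (Cabs lb * Cabs lb)))); [| field; lra].
    replace (1 - l1 * l1) with (Cabs lb * Cabs lb) by lra.
    replace (Cabs q * Cabs q) with ((1 - p) * (1 + p)) by lra.
    field; lra.
Qed.

(** Here [l1 = l2] is [1] or [-1]. Within [1 / 2] of it [a1 + a2] is nonzero, so [b] vanishes
    exactly; then [a1] and [a2] are signs close to [l1], hence equal to it. *)
Lemma walk_zero_columns :
  lb = C0 -> l1 = l2 ->
  exists N, forall x, D N x -> zero_column (walk_A p q b) (walk_V q a1 a2) (walk_B p q b) x.
Proof.
intros Hlb Hl; destruct (limit_coin D a1 a2 b l1 l2 lb) as [E1 [E2 _]]; try easy.
rewrite Hlb, Cnorm2_C0 in E1.
destruct (H1 (/ 2)) as [N1 h1]; [lra |]; destruct (H2 (/ 2)) as [N2 h2]; [lra |].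
(* Column [x] involves the coin at [x] and at [x + 1], so both sites must be beyond [K]. *)
destruct HD as [HD1 [HD2 _]]; destruct (HD1 N1 N2) as [K HK], (HD2 K) as [K' HK'],
  (HD1 K K') as [M HM].
assert (Hpt : forall x, D K x -> b x = C0 /\ a1 x = l1 /\ a2 x = l1).
{ intros x hx; destruct (HK x hx) as [hx1 hx2].
  specialize (h1 x hx1); specialize (h2 x hx2); rewrite <- Hl in h2.
  apply Rabs_def2 in h1; apply Rabs_def2 in h2.
  assert (hl : l1 = 1 \/ l1 = -1).
  { destruct (Rmult_integral (l1 - 1) (l1 + 1)); [lra | left; lra | right; lra]. }
  assert (Hbx : b x = C0).
  { destruct (Cmul_integral _ _ (Hab x)) as [h | h]; [easy |].
    apply (f_equal fst) in h; simpl in h; destruct hl; lra. }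
  pose proof (Ha1 x) as e1; pose proof (Ha2 x) as e2; rewrite Hbx, Cnorm2_C0 in e1, e2.
  assert (hs : forall t, t * t + 0 = 1 -> - / 2 < t - l1 < / 2 -> t = l1).
  { intros t ht hd; destruct (Rmult_integral (t - 1) (t + 1)); destruct hl; lra. }
  split; [easy |]; split; apply hs; lra. }
exists M; intros x hx; destruct (HM x hx) as [hx1 hx2]; apply HK' in hx2.
apply Hpt in hx1; apply Hpt in hx2; destruct hx1 as [x1 [x2 x3]], hx2 as [y1 [y2 y3]].
unfold zero_column, walk_A, walk_V, walk_B.
replace (x - 1 + 1)%Z with x by lia; rewrite x1, y1, x2, y3.
split; [ring | split]; [rewrite Rminus_diag; change (RtoC 0) with C0; ring |].
replace (Cconj C0) with C0 by (cx_eq; ring); ring.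
Qed.

Lemma walk_end_dichotomy :
  (lb <> C0 -> Rabs p <> Rabs l1) ->
  (exists N, forall x, D N x -> zero_column (walk_A p q b) (walk_V q a1 a2) (walk_B p q b) x)
  \/ exists K, bounded_below_on everywhere (const_band lA lV lB) K.
Proof.
intro H; destruct (classic (lb = C0)) as [Hlb | Hlb].
- destruct (Req_dec l1 l2) as [Hl | Hl]; [left; now apply walk_zero_columns | right].
  replace lA with C0 by (unfold lA; rewrite Hlb; ring).
  replace lB with C0 by (unfold lB; rewrite Hlb; replace (Cconj C0) with C0 by (cx_eq; ring); ring).
  apply scalar_bounded_below; intro h; apply (f_equal Cnorm2) in h.
  unfold lV, diag_coef in h.
  rewrite !Cnorm2_mul, !Cnorm2_RtoC, Cabs_sqr, Cnorm2_half_i, Cnorm2_C0 in h.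
  pose proof (Cnorm2_pos q Hq).
  assert (0 < (l2 - l1) * (l2 - l1)) by (apply Rsqr_pos_lt; lra); nra.
- right; apply walk_limit_bounded_below; auto.
Qed.

End WalkEnd.

Theorem theorem5p3
  (p : R) (q : Cx) (a1 a2 : Z -> R) (b : Z -> Cx)
  (a1L a2L a1R a2R : R) (bL bR : Cx)
  (Hq : q <> C0)
  (Hpq : p * p + Cnorm2 q = 1)
  (Ha1 : forall x : Z, a1 x * a1 x + Cnorm2 (b x) = 1)
  (Ha2 : forall x : Z, a2 x * a2 x + Cnorm2 (b x) = 1)
  (Hb : forall x : Z, Cmul (b x) (RtoC (a1 x + a2 x)) = C0)
  (HL1 : lim_left_R a1 a1L) (HL2 : lim_left_R a2 a2L) (HLb : lim_left_C b bL)
  (HR1 : lim_right_R a1 a1R) (HR2 : lim_right_R a2 a2R) (HRb : lim_right_C b bR) :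
  closed_range (Qeps p q a1 a2 b) <->
  ((bL <> C0 -> Rabs p <> Rabs a1L) /\ (bR <> C0 -> Rabs p <> Rabs a1R)).
Proof.
rewrite Qeps_band.
pose proof (walk_coef_bound p q a1 a2 b Hq Hpq Ha1 Ha2) as Hk.
pose proof (walk_lim_A to_left p q b bL direction_left HLb) as LA.
pose proof (walk_lim_V to_left q a1 a2 a1L a2L direction_left HL1 HL2) as LV.
pose proof (walk_lim_B to_left p q b bL HLb) as LB.
pose proof (walk_lim_A to_right p q b bR direction_right HRb) as RA.
pose proof (walk_lim_V to_right q a1 a2 a1R a2R direction_right HR1 HR2) as RV.
pose proof (walk_lim_B to_right p q b bR HRb) as RB.
split.
(* At an end where the condition fails the limiting symbol has a unimodular zero and nonzero
   off-diagonal limits, which excludes closed range. *)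
- intro Hcl; split; intros Hlb Habs; revert Hcl.
  + destruct (walk_symbol_zero to_left p q a1 a2 b a1L a2L bL) as [z [Hz1 Hz2]];
      try easy; [apply direction_left |].
    destruct (walk_limit_nonzero p q bL Hq Hpq Hlb).
    eapply not_closed_range_left; eauto.
  + destruct (walk_symbol_zero to_right p q a1 a2 b a1R a2R bR) as [z [Hz1 Hz2]];
      try easy; [apply direction_right |].
    destruct (walk_limit_nonzero p q bR Hq Hpq Hlb).
    eapply not_closed_range_right; eauto.
- intros [HL HR]; apply closed_range_of_ends with 1; [easy | |].
  + destruct (walk_end_dichotomy to_left p q a1 a2 b a1L a2L bL) as [[N HN] | [K HK]];
      try easy; [apply direction_left | eapply left_end_ok_zero; eauto |].
    eapply left_end_ok_limit; eauto.
  + destruct (walk_end_dichotomy to_right p q a1 a2 b a1R a2R bR) as [[N HN] | [K HK]];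
      try easy; [apply direction_right | eapply right_end_ok_zero; eauto |].
    eapply right_end_ok_limit; eauto.
Qed.
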